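(* Let $S$ be the basic spinor representation of $Spin(3)$, and let $v^{\pm}$ be generators of the one-dimensional spaces $S^{\pm}=\{u\in S:-ie_{12}u=\pm u\}$. For each $k\in\mathbb{N}_0$, the polynomials $$f^k_{2j}=e^{x_3e_3\underline{\partial}}\left(\frac{z^j\,\overline{z}^{\,k-j}}{j!(k-j)!}\,v^+\right)\quad\text{and}\quad f^k_{2j+1}=e^{x_3e_3\underline{\partial}}\left(\frac{z^j\,\overline{z}^{\,k-j}}{j!(k-j)!}\,v^-\right),\qquad j=0,\ldots,k,$$ form a Gelfand–Tsetlin basis of the irreducible $\mathfrak{so}(3)$-module $\mathcal{M}_k(\mathbb{R}^3,S)$. Moreover, for each $j=0,\ldots,2k+1$, the polynomial $f^k_j$ is a weight vector with the weight $k+\frac12-j$, that is, $Hf^k_j=(k+\frac12-j)f^k_j$, where $H=-iL_{12}$.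
   Context: The complex Clifford algebra is generated by $e_1,e_2,\dots$ with $e_j^2=-1$, $e_ie_j=-e_je_i$ ($i\neq j$); $e_{ij}=e_ie_j$. $Spin(3)$ is the group of products of an even number of unit vectors of $\mathbb{R}^3=\mathrm{span}_{\mathbb{R}}\{e_1,e_2,e_3\}$. $S$ is the (two-dimensional complex) basic spinor representation of $Spin(3)$, realized as a subspace of a complex Clifford algebra containing $e_1,e_2,e_3$, invariant under left multiplication by $Spin(3)$; as an $\mathfrak{so}(2)$-module $S=S^+\oplus S^-$. $x=(x_1,x_2,x_3)\in\mathbb{R}^3$, $z=x_1+ix_2$, $\overline{z}=x_1-ix_2$, $\underline{\partial}=e_1\frac{\partial}{\partial x_1}+e_2\frac{\partial}{\partial x_2}$, $\partial=\underline{\partial}+e_3\frac{\partial}{\partial x_3}$. For a polynomial $p$ in $(x_1,x_2)$ of degree $k$, $e^{x_3e_3\underline{\partial}}p=\sum_{s=0}^k\frac{x_3^s}{s!}(e_3\underline{\partial})^sp$. $\mathcal{M}_k(\mathbb{R}^3,S)$ is the space of $S$-valued $k$-homogeneous polynomials $P$ on $\mathbb{R}^3$ with $\partial P=0$. $\mathfrak{so}(3)=\mathrm{span}\{e_{12},e_{23},e_{31}\}$ acts on $\mathcal{M}_k(\mathbb{R}^3,S)$ by letting $e_{ij}/2$ act as $L_{ij}=\frac{e_{ij}}2+x_j\frac{\partial}{\partial x_i}-x_i\frac{\partial}{\partial x_j}$ ($i\ne j$); $\mathfrak{so}(2)=\mathrm{span}\{e_{12}\}$. A Gelfand–Tsetlin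 basis of an irreducible $\mathfrak{so}(3)$-module $V$ (with respect to the chain $\mathfrak{so}(3)\supset\mathfrak{so}(2)$) is a basis obtained by choosing one non-zero vector in each summand of the multiplicity-free decomposition of $V$ into (one-dimensional) irreducible $\mathfrak{so}(2)$-modules. *)

(* Defs.v *)
From HB Require Import structures.
From mathcomp Require Import all_boot all_order all_algebra all_field.
From mathcomp Require Import complex.
From mathcomp Require Import mpoly.
From mathcomp Require Import reals.

Set Implicit Arguments.
Unset Strict Implicit.
Unset Printing Implicit Defensive.

Import GRing.Theory.
Local Open Scope ring_scope.

Section SymmetricDifference.
Variable T : finType.
Implicit Types A B D : {set T}.

Definition sdiff A B : {set T} := [set x | (x \in A) (+) (x \in B)].

Lemma sdiffA A B D : sdiff A (sdiff B D) = sdiff (sdiff A B) D.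
Proof. by apply/setP=> x; rewrite !inE addbA. Qed.

Lemma sdiffC A B : sdiff A B = sdiff B A.
Proof. by apply/setP=> x; rewrite !inE addbC. Qed.

Lemma sdiffK A B : sdiff A (sdiff A B) = B.
Proof. by apply/setP=> x; rewrite !inE addbA addbb. Qed.

Lemma sdiff0 A : sdiff A set0 = A.
Proof. by apply/setP=> x; rewrite !inE addbF. Qed.

Lemma sdiffv A : sdiff A A = set0.
Proof. by apply/setP=> x; rewrite !inE addbb. Qed.

End SymmetricDifference.

(* The coefficient at A is the coordinate along the blade e_A, the product of *)
(* the e_i, i in A, taken in increasing order.                                *)
Definition clifford (F : fieldType) (n : nat) := {ffun {set 'I_n} -> F^o}.

Section Clifford.
Variables (F : fieldType) (n : nat).
Local Notation Cl := (clifford F n).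
Implicit Types (A B D : {set 'I_n}) (a b c : Cl).

HB.instance Definition _ := Vector.on Cl.

(* e_A e_B = clsign A B *: e_(A xor B): moving e_j leftwards past the e_i     *)
(* with i > j costs one sign each, and so does each e_j ^ 2 = -1.             *)
Definition clsign A B : F :=
  \prod_(i in A) \prod_(j : 'I_n | (j \in B) && (j <= i)%N) -1.

Definition clmul a b : Cl :=
  [ffun D => \sum_A clsign A (sdiff A D) * (a A * b (sdiff A D))].

Definition blade A : Cl := [ffun B => (B == A)%:R].

Lemma clsignE A B : clsign A B =
  \prod_(i < n) \prod_(j < n | (j <= i)%N) (-1) ^+ ((i \in A) && (j \in B)).
Proof.
rewrite /clsign big_mkcond /=; apply: eq_bigr => i _.
case: (i \in A) => /=; last by rewrite big1.
rewrite big_mkcondl /=; apply: eq_bigr => j _.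
by case: (j \in B).
Qed.

Lemma clsignDl A B D : clsign (sdiff A B) D = clsign A D * clsign B D.
Proof.
rewrite !clsignE -big_split; apply: eq_bigr => i _.
rewrite -big_split; apply: eq_bigr => j _ /=; rewrite inE.
by case: (i \in A); case: (i \in B); case: (j \in D); rewrite /= ?(expr0, expr1, mulrNN, mulr1, mul1r).
Qed.

Lemma clsignDr A B D : clsign A (sdiff B D) = clsign A B * clsign A D.
Proof.
rewrite !clsignE -big_split; apply: eq_bigr => i _.
rewrite -big_split; apply: eq_bigr => j _ /=; rewrite inE.
by case: (i \in A); case: (j \in B); case: (j \in D); rewrite /= ?(expr0, expr1, mulrNN, mulr1, mul1r).
Qed.

Lemma clsign0l B : clsign set0 B = 1.
Proof. by rewrite /clsign big_set0. Qed.

Lemma clsign0r A : clsign A set0 = 1.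
Proof. by rewrite /clsign big1 // => i _; rewrite big1 // => j; rewrite inE. Qed.

Fact clmulA : associative clmul.
Proof.
move=> a b c; apply/ffunP=> D; rewrite !ffunE.
transitivity (\sum_A \sum_B clsign A (sdiff B (sdiff B (sdiff A D))) *
   clsign B (sdiff B (sdiff A D)) * (a A * (b B * c (sdiff B (sdiff A D))))).
  apply: eq_bigr => A _; rewrite ffunE !mulr_sumr; apply: eq_bigr => B _.
  rewrite sdiffK -!mulrA; congr (_ * _).
  by rewrite mulrCA.
transitivity (\sum_B \sum_A clsign B (sdiff B D) *
   (clsign A (sdiff A B) * (a A * b (sdiff A B))) * c (sdiff B D)); last first.
  by apply: eq_bigr => B _; rewrite ffunE mulr_suml mulr_sumr;
     apply: eq_bigr => A _; rewrite -[LHS]mulrA.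
rewrite [RHS]exchange_big; apply: eq_bigr => A _ /=.
rewrite [RHS](reindex_inj (can_inj (sdiffK A))) /=.
apply: eq_bigr => B _; rewrite !(sdiffK A B).
have -> : sdiff (sdiff A B) D = sdiff B (sdiff A D).
  by rewrite sdiffA (sdiffC B).
rewrite [clsign A (sdiff B (sdiff B _))]clsignDr clsignDl.
set E := sdiff B (sdiff A D); rewrite !mulrA; congr (_ * _ * _ * _).
by rewrite -!mulrA mulrC -!mulrA.
Qed.

Fact cl1mul : left_id (blade set0) clmul.
Proof.
move=> a; apply/ffunP=> D; rewrite ffunE (bigD1 set0) //= big1 => [|A nzA].
  by rewrite ffunE eqxx clsign0l sdiffC sdiff0 !mul1r addr0.
by rewrite ffunE (negbTE nzA) mul0r mulr0.
Qed.

Fact clmul1 : right_id (blade set0) clmul.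
Proof.
move=> a; apply/ffunP=> D; rewrite ffunE (bigD1 D) //= big1 => [|A nzA].
  by rewrite ffunE sdiffv eqxx clsign0r mulr1 mul1r addr0.
rewrite ffunE; case: eqP => [E|_]; last by rewrite !mulr0.
by case/eqP: nzA; rewrite -(sdiffK A D) E sdiff0.
Qed.

Fact clmulDl : left_distributive clmul +%R.
Proof.
move=> a b c; apply/ffunP=> D; rewrite !ffunE -big_split; apply: eq_bigr => A _.
by rewrite !ffunE mulrDl mulrDr.
Qed.

Fact clmulDr : right_distributive clmul +%R.
Proof.
move=> a b c; apply/ffunP=> D; rewrite !ffunE -big_split; apply: eq_bigr => A _.
by rewrite !ffunE !mulrDr.
Qed.

Fact cl1_neq0 : blade set0 != 0.
Proof. by apply/eqP=> /ffunP/(_ set0)/eqP; rewrite !ffunE eqxx oner_eq0. Qed.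

HB.instance Definition _ := GRing.Zmodule_isNzRing.Build Cl
  clmulA cl1mul clmul1 clmulDl clmulDr cl1_neq0.

Fact clscaleAl (k : F) a b : k *: (a * b) = (k *: a) * b.
Proof.
apply/ffunP=> D; rewrite !ffunE /GRing.scale /= mulr_sumr; apply: eq_bigr => A _.
by rewrite !ffunE mulrCA !mulrA.
Qed.

HB.instance Definition _ := GRing.Lmodule_isLalgebra.Build F Cl clscaleAl.

Fact clscaleAr (k : F) a b : k *: (a * b) = a * (k *: b).
Proof.
apply/ffunP=> D; rewrite !ffunE /GRing.scale /= mulr_sumr; apply: eq_bigr => A _.
by rewrite !ffunE mulrCA; congr (_ * _); rewrite mulrCA.
Qed.

HB.instance Definition _ := GRing.Lalgebra_isAlgebra.Build F Cl clscaleAr.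
HB.instance Definition _ := Algebra_isFalgebra.Build F Cl.

Definition clgen (i : 'I_n) : Cl := blade [set i].

Lemma blade_mul A B : blade A * blade B = clsign A B *: blade (sdiff A B).
Proof.
apply/ffunP=> D; rewrite !ffunE (bigD1 A) //= big1 => [|A' nzA].
  rewrite !ffunE eqxx mul1r addr0 /GRing.scale /=.
  case: (sdiff A D =P B) => [<-|neB]; first by rewrite sdiffK eqxx.
  by case: eqP => [eD|_]; [case: neB; rewrite eD sdiffK | rewrite !mulr0].
by rewrite ffunE (negbTE nzA) mul0r mulr0.
Qed.

Lemma clsign1 i j : clsign [set i] [set j] = if (j <= i)%N then -1 else 1.
Proof.
rewrite /clsign big_set1; case: ifP => le_ji.
  rewrite (bigD1 j) /= ?set11 ?le_ji // big1 ?mulr1 // => l.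
  by rewrite inE; case/andP=> /andP[/eqP-> _]; rewrite eqxx.
by rewrite big1 // => l /andP[/set1P->]; rewrite le_ji.
Qed.

Lemma clgen_sqr i : clgen i * clgen i = -1.
Proof. by rewrite blade_mul clsign1 leqnn sdiffv scaleN1r. Qed.

Lemma clgen_anticomm i j : i != j -> clgen i * clgen j = - (clgen j * clgen i).
Proof.
move=> neq_ij; rewrite !blade_mul !clsign1 (sdiffC [set j]) -scaleNr.
by case: (ltngtP i j) neq_ij => [_ _|_ _|/val_inj->]; rewrite ?opprK ?eqxx.
Qed.

End Clifford.

(* Clifford-valued polynomials on R^3. The left multiplication by Clifford    *)
(* numbers is the one of the ring {mpoly clifford F n[3]}; the alias carries  *)
(* the vector space structure over F instead of the one over clifford F n.    *)
Definition clpoly (F : fieldType) (n : nat) := {mpoly (clifford F n)[3]}.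

Section ClPoly.
Variables (F : fieldType) (n : nat).
Local Notation P3 := (clpoly F n).

HB.instance Definition _ := GRing.NzRing.on P3.

Definition clpscale (c : F) (p : P3) : P3 := (c%:A : clifford F n)%:MP * p.

Fact clpscaleA a b (p : P3) : clpscale a (clpscale b p) = clpscale (a * b) p.
Proof. by rewrite /clpscale mulrA -mpolyCM -scalerAl mul1r scalerA. Qed.

Fact clpscale1 : left_id 1 clpscale.
Proof. by move=> p; rewrite /clpscale scale1r mpolyC1 mul1r. Qed.

Fact clpscaleDr : right_distributive clpscale +%R.
Proof. by move=> a p q; rewrite /clpscale mulrDr. Qed.

Fact clpscaleDl (p : P3) : {morph clpscale^~ p : a b / a + b}.
Proof. by move=> a b; rewrite /clpscale scalerDl mpolyCD mulrDl. Qed.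

HB.instance Definition _ := GRing.Zmodule_isLmodule.Build F P3
  clpscaleA clpscale1 clpscaleDr clpscaleDl.

End ClPoly.

Section Modules.
Variables (F : fieldType) (T : lmodType F).
Implicit Types V W : T -> Prop.

Definition subspace V :=
  V 0 /\ forall a u v, V u -> V v -> V (a *: u + v).

Definition basis_of_subspace V n (b : 'I_n -> T) :=
  [/\ forall i, V (b i),
      forall c : 'I_n -> F, \sum_i c i *: b i = 0 -> forall i, c i = 0
    & forall v, V v -> exists c : 'I_n -> F, v = \sum_i c i *: b i].

Definition direct_sum V n (Vs : 'I_n -> T -> Prop) :=
  [/\ forall i v, Vs i v -> V v,
      forall u : 'I_n -> T, (forall i, Vs i (u i)) ->
        \sum_i u i = 0 -> forall i, u i = 0
    & forall v, V v ->
        exists2 u : 'I_n -> T, forall i, Vs i (u i) & v = \sum_i u i].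

(* A Lie algebra g acting on T; X : g acts as act X.                          *)
Variables (g : Type) (act : g -> T -> T).

Definition submodule V :=
  subspace V /\ forall X u, V u -> V (act X u).

Definition irreducible V :=
  [/\ submodule V, exists2 u, V u & u != 0
    & forall W, submodule W -> (forall u, W u -> V u) ->
        (forall u, W u -> u = 0) \/ (forall u, V u -> W u)].

Definition isomorphic V W :=
  exists phi : T -> T,
    [/\ forall u, V u -> W (phi u),
        forall a u v, V u -> V v -> phi (a *: u + v) = a *: phi u + phi v,
        forall u, V u -> phi u = 0 -> u = 0,
        forall w, W w -> exists2 u, V u & phi u = w
      & forall X u, V u -> phi (act X u) = act X (phi u)].

End Modules.

(* The Gelfand-Tsetlin bases of an irreducible module V for a chain g > h     *)
(* whose second member is abelian; actg and acth are the actions of g and h.  *)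
(* The summands Vs i are lines, as the vectors b i chosen in them form a      *)
(* basis of V.                                                                *)
Definition gelfand_tsetlin_basis (F : fieldType) (T : lmodType F)
    (g h : Type) (actg : g -> T -> T) (acth : h -> T -> T)
    (V : T -> Prop) (n : nat) (b : 'I_n -> T) :=
  [/\ irreducible actg V, basis_of_subspace V b
    & exists Vs : 'I_n -> T -> Prop,
        [/\ direct_sum V Vs, forall i, irreducible acth (Vs i),
            forall i j, i != j -> ~ isomorphic acth (Vs i) (Vs j)
          & forall i, Vs i (b i) /\ b i != 0]].

Section Monogenic.
Variables (R : realType) (m : nat).
Local Notation C := R[i].
(* e_1, e_2, e_3 are the first three of the 3 + m generators. *)
Local Notation Cl := (clifford C (3 + m)).
Local Notation P3 := (clpoly C (3 + m)).
Local Notation i1 := (@Ordinal 3 0 isT).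
Local Notation i2 := (@Ordinal 3 1 isT).
Local Notation i3 := (@Ordinal 3 2 isT).
Local Notation I := ('i%C : C).
Implicit Types (p q : P3) (u v a : Cl) (S : {vspace Cl}).

Definition evec (i : 'I_3) : Cl := clgen C (lshift m i).

Definition vec3 (x : 'rV[R]_3) : Cl := \sum_i (x 0 i)%:C%C *: evec i.

Definition Spin3 (s : Cl) :=
  exists xs : seq 'rV[R]_3,
    [/\ ~~ odd (size xs), forall x, x \in xs -> \sum_i x 0 i ^+ 2 = 1
      & s = \prod_(x <- xs) vec3 x].

(* The complex span of Spin(3) is a 2 x 2 matrix algebra, so that all its     *)
(* two-dimensional modules are copies of the basic spinor representation.     *)
Definition basic_spinor S :=
  \dim S = 2%N /\ forall s u, Spin3 s -> u \in S -> s * u \in S.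

Definition Sweight S (c : C) : {vspace Cl} :=
  (S :&: passmx.leigenspace (amull (- I *: (evec i1 * evec i2))) c)%VS.
Definition Splus S := Sweight S 1.
Definition Sminus S := Sweight S (-1).

Lemma mem_Sweight S c u :
  (u \in Sweight S c) =
  (u \in S) && (- I *: (evec i1 * evec i2 * u) == c *: u).
Proof.
by rewrite memv_cap memv_ker !lfun_simp /= -scalerAl subr_eq0.
Qed.

Definition xvar (i : 'I_3) : P3 := 'X_i.
Definition cst a : P3 := a%:MP.
Definition pderiv (i : 'I_3) p : P3 := mderiv i p.

Definition dirac2 p : P3 :=
  cst (evec i1) * pderiv i1 p + cst (evec i2) * pderiv i2 p.
Definition dirac p : P3 := dirac2 p + cst (evec i3) * pderiv i3 p.

(* A polynomial is S-valued when its coefficients are in S. *)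
Definition monogenic (k : nat) S p :=
  [/\ forall mon, p@_mon \in S, p \is k.-homog & dirac p = 0].

Definition Lop (i j : 'I_3) p : P3 :=
  cst (2^-1 *: (evec i * evec j)) * p
  + xvar j * pderiv i p - xvar i * pderiv j p.

(* The row a stands for a_1 e_12/2 + a_2 e_23/2 + a_3 e_31/2 in so(3), and    *)
(* t : R for t e_12/2 in so(2).                                               *)
Definition so3_act (a : 'rV[R]_3) p : P3 :=
  (a 0 i1)%:C%C *: Lop i1 i2 p + (a 0 i2)%:C%C *: Lop i2 i3 p
  + (a 0 i3)%:C%C *: Lop i3 i1 p.
Definition so2_act (t : R) p : P3 := t%:C%C *: Lop i1 i2 p.

Definition Hop p : P3 := - I *: Lop i1 i2 p.

Definition zpoly : P3 := xvar i1 + I *: xvar i2.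
Definition zbarpoly : P3 := xvar i1 - I *: xvar i2.

(* exp (x_3 e_3 dirac2), on polynomials in (x_1, x_2) of degree k. *)
Definition exp_x3 (k : nat) p : P3 :=
  \sum_(s < k.+1) (s`!%:R^-1 : C) *:
    (xvar i3 ^+ s * iter s (fun q => cst (evec i3) * dirac2 q) p).

Definition gt_poly (k j : nat) v : P3 :=
  exp_x3 k (((j`! * (k - j)`!)%:R^-1 : C) *:
              (zpoly ^+ j * zbarpoly ^+ (k - j) * cst v)).

(* f^k_n: gt_poly k j vp if n = 2 j, and gt_poly k j vm if n = 2 j + 1. *)
Definition gt_family (vp vm : Cl) (k n : nat) : P3 :=
  gt_poly k n./2 (if odd n then vm else vp).

End Monogenic.

(* Main.v *)
From HB Require Import structures.
Require Import Defs.
From mathcomp Require Import all_boot all_order all_algebra all_field.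
From mathcomp Require Import complex reals.
From mathcomp Require Import mpoly boolp ssrAC ring zify.

(** A monogenic polynomial on three-space is determined by its restriction to the
    plane [x_3 = 0]. Indeed, multiplying the Dirac equation by the invertible
    [e_3] turns it into an evolution equation in [x_3] whose generator is [e_3]
    times the planar Dirac operator ([monogenicP]); its solution is the
    exponential series of the statement ([ckexp_monogenic]), and it is unique
    ([monogenic_planar_uniq]). So [M_k] embeds into the [S]-valued homogeneous
    polynomials of degree [k] in two variables, a space of dimension [2 k + 2].

    The operators [L_ij] commute with the Dirac operator ([dirac_Lop]) and satisfy
    the relations of so(3) ([Lop_comm]); both facts hold because generators,
    variables and derivations all transform as vectors. Moreover [L_12] commutes
    with the exponential, so the weight of [f_n] is that of its planar part:
    [z] lowers the weight by 1, the conjugate of [z] raises it by 1, and the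
    spinors contribute plus or minus one half ([gt_poly_weight]). Both spinor
    weight spaces are nonzero ([Sweight_neq0]), hence the [f_n] are nonzero; as
    their weights are distinct they are independent, and their number is the
    dimension of the space above, so they form a basis ([gt_family_basis]).

    Irreducibility follows from the weights alone ([ladder_irreducible]): a nonzero
    submodule contains a weight vector, and the ladder operators pass from each
    weight line to the next in both directions, with coefficients whose products
    are forced to be nonzero by the commutation relations. Finally, the weight
    lines are pairwise non-isomorphic so(2)-modules, having distinct weights. *)

Set Implicit Arguments.
Unset Strict Implicit.
Unset Printing Implicit Defensive.

Import GRing.Theory Num.Theory.
Local Open Scope ring_scope.

Local Notation i1 := (@Ordinal 3 0 isT).
Local Notation i2 := (@Ordinal 3 1 isT).
Local Notation i3 := (@Ordinal 3 2 isT).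

(** * Weight vectors, ladders and irreducibility *)

Section Subspaces.
Variables (F : fieldType) (T : lmodType F) (W : T -> Prop).
Hypothesis subW : subspace W.

Lemma subspace0 : W 0. Proof. by case: subW. Qed.

Lemma subspaceZ a u : W u -> W (a *: u).
Proof. by case: subW => W0 WL Wu; rewrite -[_ *: _]addr0; apply: WL. Qed.

Lemma subspaceD u v : W u -> W v -> W (u + v).
Proof. by case: subW => _ WL Wu Wv; rewrite -[u]scale1r; apply: WL. Qed.

Lemma subspaceB u v : W u -> W v -> W (u - v).
Proof. by move=> Wu Wv; rewrite -scaleN1r; apply/subspaceD/subspaceZ. Qed.

Lemma subspace_sum (I : finType) (u : I -> T) :
  (forall i, W (u i)) -> W (\sum_i u i).
Proof.
by move=> Wu; apply: (big_ind W) => // [|x y]; [apply: subspace0 | apply: subspaceD].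
Qed.

(** Applying the product of the [op - lam l] over all [l != i] to the sum kills
    every term but the [i]-th, which it multiplies by a nonzero scalar. For the
    zero subspace this is the independence of eigenvectors; for a submodule it
    extracts the weight components of its elements. *)
Lemma eigenvector_component (op : {linear T -> T}) n (lam : 'I_n -> F)
    (u : 'I_n -> T) :
    (forall w, W w -> W (op w)) -> injective lam ->
    (forall i, op (u i) = lam i *: u i) ->
  W (\sum_i u i) -> forall i, W (u i).
Proof.
move=> opW lam_inj eig Wu i.
have Ws (s : seq 'I_n) : W (\sum_j (\prod_(l <- s) (lam j - lam l)) *: u j).
  elim: s => [|l s IHs].
    by under eq_bigr do rewrite big_nil scale1r.
  have -> : \sum_j (\prod_(r <- l :: s) (lam j - lam r)) *: u j =
      op (\sum_j (\prod_(r <- s) (lam j - lam r)) *: u j)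
      - lam l *: (\sum_j (\prod_(r <- s) (lam j - lam r)) *: u j).
    rewrite linear_sum scaler_sumr -sumrB; apply: eq_bigr => j _.
    by rewrite linearZ /= eig !scalerA -scalerBl big_cons mulrBl mulrC.
  by apply/subspaceB/subspaceZ/IHs/opW/IHs.
have := Ws (enum (predC1 i)).
rewrite (bigD1 i) //= [X in _ + X]big1 ?addr0 => [|j ji]; last first.
  rewrite (big_rem j) /= ?subrr ?mul0r ?scale0r //.
  by rewrite mem_enum inE.
set c := \prod_(_ <- _) _ => /(subspaceZ c^-1); rewrite scalerA mulVf ?scale1r //.
rewrite prodf_seq_neq0; apply/allP=> l; rewrite mem_enum inE /= => li.
by rewrite subr_eq0 (inj_eq lam_inj) eq_sym.
Qed.

End Subspaces.

Lemma trivial_subspace (F : fieldType) (T : lmodType F) :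
  subspace (fun u : T => u = 0).
Proof. by split=> // a u v -> ->; rewrite scaler0 addr0. Qed.

Lemma eigenvectors_independent (F : fieldType) (T : lmodType F)
    (op : {linear T -> T}) n (lam : 'I_n -> F) (b : 'I_n -> T) :
    injective lam -> (forall i, op (b i) = lam i *: b i) ->
    (forall i, b i != 0) ->
  forall c : 'I_n -> F, \sum_i c i *: b i = 0 -> forall i, c i = 0.
Proof.
move=> lam_inj eig nzb c sum0 i; apply/eqP.
have opZ j : op (c j *: b j) = lam j *: (c j *: b j).
  by rewrite linearZ /= eig !scalerA mulrC.
have := eigenvector_component (trivial_subspace T) _ lam_inj opZ sum0 i.
move=> /(_ _)/eqP; rewrite scaler_eq0 (negbTE (nzb i)) orbF; apply=> w ->.
exact: linear0.
Qed.

(** The matrix entries of the ladder operators in a basis of weight vectors need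
    not be computed. As the weights are distinct, [E] and [G] send each [b j] to
    a multiple of its neighbour, and the commutator of [E] and [G] determines the
    product of the two coefficients between [b j] and [b j.+1] by a telescoping
    sum of the weights. The assumption [highest] says that [mu] is half the
    number of steps of the ladder, which makes every such product nonzero. *)
Section Ladder.
Variables (F : numFieldType) (T : lmodType F) (V : T -> Prop).
Variables (n : nat) (b : nat -> T) (mu kappa : F) (H E G : {linear T -> T}).
Hypothesis basisV : basis_of_subspace V (fun j : 'I_n => b j).
Hypotheses (stableE : forall u, V u -> V (E u))
           (stableG : forall u, V u -> V (G u)).
Hypothesis weight : forall j, (j < n)%N -> H (b j) = (mu - j%:R) *: b j.
Hypothesis highest : mu *+ 2 = n.-1%:R.
Hypothesis kappa_neq0 : kappa != 0.
Hypothesis HE : forall u, V u -> H (E u) - E (H u) = E u.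
Hypothesis HG : forall u, V u -> H (G u) - G (H u) = - G u.
Hypothesis EG : forall u, V u -> E (G u) - G (E u) = kappa *: H u.

Let bV j : (j < n)%N -> V (b j).
Proof. by move=> jn; have [bV _ _] := basisV; apply: (bV (Ordinal jn)). Qed.

Lemma basis_neq0 j : (j < n)%N -> b j != 0.
Proof.
move=> jn; apply/eqP=> b0; case: basisV => _ indep _.
have sum0 : \sum_(i < n) (i == Ordinal jn)%:R *: b i = 0.
  by apply: big1 => i _; case: eqP => [->|_]; rewrite /= ?b0 ?scaler0 ?scale0r.
by have /eqP := indep _ sum0 (Ordinal jn); rewrite eqxx oner_eq0.
Qed.

Lemma weight_space_coord (c : 'I_n -> F) lam (j : 'I_n) :
  H (\sum_i c i *: b i) = lam *: \sum_i c i *: b i ->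
  mu - j%:R != lam -> c j = 0.
Proof.
case: basisV => _ indep _ eig ne; apply/eqP; apply: contraNT ne => cj.
suff /(_ j)/eqP : forall i : 'I_n, (mu - i%:R - lam) * c i = 0.
  by rewrite mulf_eq0 (negbTE cj) orbF subr_eq0.
apply: (indep (fun i : 'I_n => (mu - i%:R - lam) * c i)) => /=.
transitivity (H (\sum_i c i *: b i) - lam *: \sum_i c i *: b i).
  rewrite linear_sum scaler_sumr -sumrB; apply: eq_bigr => i _.
  rewrite linearZ /= weight // !scalerA -scalerBl; congr (_ *: _).
  by rewrite mulrBl [c i * _]mulrC.
by rewrite eig subrr.
Qed.

Lemma weight_space u j :
  V u -> H u = (mu - j%:R) *: u -> (j < n)%N -> exists a, u = a *: b j.
Proof.
case: basisV => _ _ gen Vu eig jn; have [c u_c] := gen u Vu.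
exists (c (Ordinal jn)); rewrite u_c in eig *.
rewrite (bigD1 (Ordinal jn)) //= big1 ?addr0 // => i ij.
rewrite (weight_space_coord eig) ?scale0r //.
by rewrite (inj_eq (subrI _)) eqr_nat -val_eqE in ij *.
Qed.

(** [mu + 1] is not a weight of [V]. *)
Lemma raise_highest : (0 < n)%N -> E (b 0%N) = 0.
Proof.
move=> n_gt0; have VE := stableE (bV n_gt0).
case: basisV => _ _ gen; have [c Ec] := gen _ VE.
have eig : H (E (b 0%N)) = (mu + 1) *: E (b 0%N).
  rewrite -[LHS](subrK (E (H (b 0%N)))) (HE (bV n_gt0)) weight // subr0.
  by rewrite linearZ /= scalerDl scale1r addrC.
rewrite Ec in eig *; rewrite big1 // => i _.
rewrite (weight_space_coord eig) ?scale0r //.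
rewrite (inj_eq (addrI _)) eq_sym -subr_eq0 opprK.
by rewrite nat1r pnatr_eq0.
Qed.

Lemma raise j : (j.+1 < n)%N -> exists a, E (b j.+1) = a *: b j.
Proof.
move=> jn; apply: weight_space (ltnW jn); first exact/stableE/bV.
rewrite -[LHS](subrK (E (H (b j.+1)))) (HE (bV jn)) weight //.
rewrite linearZ /= -{1}[E _]scale1r -scalerDl; congr (_ *: _).
by rewrite -natr1; ring.
Qed.

Lemma lower j : (j.+1 < n)%N -> exists a, G (b j) = a *: b j.+1.
Proof.
move=> jn; apply: weight_space => //; first exact/stableG/bV/ltnW.
rewrite -[LHS](subrK (G (H (b j)))) (HG (bV (ltnW jn))) weight ?(ltnW jn) //.
rewrite linearZ /= -scaleN1r -scalerDl.
by congr (_ *: _); rewrite -natr1; ring.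
Qed.

(** Induction on [j]: [E G = G E + kappa H], and [G E] has on [b j.+1] the same
    eigenvalue as [E G] on [b j], both being the product of the same two ladder
    coefficients. The eigenvalue is [kappa] times the sum of the weights of
    [b 0, ..., b j]. *)
Lemma raise_lower j : (j.+1 < n)%N ->
  E (G (b j)) = (kappa * (j.+1%:R * (n.-1%:R - j%:R) / 2)) *: b j.
Proof.
have EGE j' : (j' < n)%N ->
    E (G (b j')) = G (E (b j')) + (kappa * (mu - j'%:R)) *: b j'.
  move=> jn; rewrite -[LHS](subrK (G (E (b j')))) (EG (bV jn)) weight //.
  by rewrite scalerA addrC.
have muE : mu = n.-1%:R / 2 by rewrite -highest -[mu *+ 2]mulr_natr mulfK ?pnatr_eq0.
elim: j => [|j IHj] jn.
  rewrite EGE ?(ltnW jn) // raise_highest ?(ltnW jn) // linear0 add0r muE.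
  by congr (_ *: _); ring.
rewrite EGE ?(ltnW jn) //.
have [a Ea] := raise (ltnW jn); have [d Gd] := lower (ltnW jn).
have EG_ad : (a * d) *: b j = E (G (b j)).
  by rewrite Gd linearZ /= Ea scalerA mulrC.
have nzb : b j != 0 by exact/basis_neq0/ltnW/ltnW.
have ad : a * d = kappa * (j.+1%:R * (n.-1%:R - j%:R) / 2).
  apply/eqP; rewrite -subr_eq0; apply/eqP.
  move: EG_ad; rewrite IHj ?(ltnW jn) // => /eqP.
  by rewrite -subr_eq0 -scalerBl scaler_eq0 (negbTE nzb) orbF => /eqP.
rewrite Ea linearZ /= Gd scalerA ad -scalerDl muE; congr (_ *: _).
by rewrite -!natr1; field.
Qed.

(** A nonzero subspace contains some [b i], since it contains the weight
    components of its elements, and hence every [b j]: no ladder coefficient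
    vanishes, so it can be climbed in both directions. *)
Lemma ladder_irreducible (W : T -> Prop) :
    subspace W -> (forall u, W u -> V u) ->
    (forall u, W u -> W (H u)) -> (forall u, W u -> W (E u)) ->
    (forall u, W u -> W (G u)) ->
  (forall u, W u -> u = 0) \/ (forall u, V u -> W u).
Proof.
move=> subW WV WH WE WG.
have [[w Ww nzw]|W0] := pselect (exists2 w, W w & w != 0); last first.
  by left=> u Wu; apply/eqP/negP=> /negP nzu; apply: W0; exists u.
have step j : (j.+1 < n)%N -> W (b j) <-> W (b j.+1).
  move=> jn; have [a Ea] := raise jn; have [d Gd] := lower jn.
  have : a * d != 0.
    have := raise_lower jn; rewrite Gd linearZ /= Ea scalerA mulrC.
    move/eqP; rewrite -subr_eq0 -scalerBl scaler_eq0.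
    rewrite (negbTE (basis_neq0 (ltnW jn))) orbF subr_eq0 => /eqP->.
    rewrite !mulf_eq0 !negb_or kappa_neq0 invr_eq0 !pnatr_eq0 /= andbT.
    by rewrite subr_eq0 eqr_nat; case: n jn => // n' jn; rewrite gtn_eqF.
  rewrite mulf_eq0 negb_or => /andP[nza nzd]; split=> Wb.
    rewrite -[b _]scale1r -(mulVf nzd) -scalerA -Gd.
    by apply: (subspaceZ subW); apply: WG.
  rewrite -[b _]scale1r -(mulVf nza) -scalerA -Ea.
  by apply: (subspaceZ subW); apply: WE.
case: (basisV) => _ _ gen; have [c w_c] := gen w (WV _ Ww).
have [i nzi] : exists i, c i != 0.
  apply/existsP; apply: contraNT nzw; rewrite negb_exists => /forallP c0.
  rewrite w_c big1 // => i _; have := c0 i; rewrite negbK => /eqP->.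
  exact: scale0r.
have Wi : W (b i).
  have lam_inj : injective (fun j : 'I_n => mu - j%:R).
    by move=> j l /(addrI mu)/oppr_inj/eqP; rewrite eqr_nat => /eqP/val_inj.
  have opZ (j : 'I_n) : H (c j *: b j) = (mu - j%:R) *: (c j *: b j).
    by rewrite linearZ /= weight // !scalerA mulrC.
  rewrite w_c in Ww; have := eigenvector_component subW WH lam_inj opZ Ww i.
  by move/(subspaceZ subW (c i)^-1); rewrite scalerA mulVf // scale1r.
have W_0 : W (b 0%N).
  have : (i < n)%N by [].
  elim: (nat_of_ord i) Wi => // j IHj Wj jn.
  by apply: IHj (ltnW jn); apply/step.
have Wj j : (j < n)%N -> W (b j).
  by elim: j => // j IHj jn; apply/(step _ jn); apply: IHj (ltnW jn).
right=> u Vu; have [c' ->] := gen u Vu.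
by apply: (subspace_sum subW) => j; apply: (subspaceZ subW); apply: Wj.
Qed.
End Ladder.

(** The complex ladder operators of a triple satisfying the relations of so(3):
    [H = - I L1], with [L2 - I L3] raising and [L2 + I L3] lowering. *)
Lemma so3_ladder_irreducible (F : numFieldType) (T : lmodType F) (V : T -> Prop)
    (n : nat) (b : nat -> T) (mu I : F) (L1 L2 L3 : {linear T -> T}) :
    I * I = -1 ->
    (forall u, L1 (L2 u) - L2 (L1 u) = L3 u) ->
    (forall u, L2 (L3 u) - L3 (L2 u) = L1 u) ->
    (forall u, L3 (L1 u) - L1 (L3 u) = L2 u) ->
    subspace V ->
    (forall u, V u -> [/\ V (L1 u), V (L2 u) & V (L3 u)]) ->
    basis_of_subspace V (fun j : 'I_n => b j) ->
    (forall j, (j < n)%N -> - I *: L1 (b j) = (mu - j%:R) *: b j) ->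
    mu *+ 2 = n.-1%:R ->
  forall W : T -> Prop, subspace W -> (forall u, W u -> V u) ->
    (forall u, W u -> [/\ W (L1 u), W (L2 u) & W (L3 u)]) ->
  (forall u, W u -> u = 0) \/ (forall u, V u -> W u).
Proof.
move=> II L12 L23 L31 subV LV basisV weight highest W subW WV LW.
pose H : {linear T -> T} := - I \*: L1.
pose E : {linear T -> T} := L2 \- I \*: L3.
pose G : {linear T -> T} := L2 \+ I \*: L3.
have e12 u : L1 (L2 u) = L3 u + L2 (L1 u) by rewrite -L12 subrK.
have e23 u : L2 (L3 u) = L1 u + L3 (L2 u) by rewrite -L23 subrK.
have e31 u : L3 (L1 u) = L2 u + L1 (L3 u) by rewrite -L31 subrK.
have HE u : H (E u) - E (H u) = E u.
  rewrite /H /E /= !linearB !linearZ /=.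
  rewrite ?e12 ?e23 ?e31 !(scalerDr, scalerN, scaleNr, opprD, scalerA,
    mulNr, mulrN, opprK, II, scale1r) !addrA.
  by rewrite [LHS](ACl (5*1*((2*4)*(3*6)))) /= !addNr !addr0.
have HG u : H (G u) - G (H u) = - G u.
  rewrite /H /G /= !linearD !linearZ /=.
  rewrite ?e12 ?e23 ?e31 !(scalerDr, scalerN, scaleNr, opprD, scalerA,
    mulNr, mulrN, opprK, II, scale1r) !addrA.
  by rewrite [LHS](ACl (5*1*((2*4)*(3*6)))) /= addNr subrr !addr0.
have EG u : E (G u) - G (E u) = - 2 *: H u.
  rewrite /H /E /G /= !linearB !linearD !linearZ /=.
  rewrite ?e12 ?e23 ?e31 !(scalerDr, scalerN, scaleNr, opprD, scalerA,
    mulNr, mulrN, opprK, II, scale1r) !addrA.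
  rewrite [LHS](ACl ((2*7)*((1*6)*(3*4)*(5*10)*(8*9)))) /= !subrr !addr0.
  by rewrite -scalerDl; congr (_ *: _); ring.
have stable (U : T -> Prop) : subspace U ->
    (forall u, U u -> [/\ U (L1 u), U (L2 u) & U (L3 u)]) ->
  forall u, U u -> [/\ U (H u), U (E u) & U (G u)].
  move=> subU LU u /LU[U1 U2 U3]; split.
  - exact: subspaceZ.
  - by apply: subspaceB => //; apply: subspaceZ.
  - by apply: subspaceD => //; apply: subspaceZ.
apply: (ladder_irreducible (kappa := -2) (H := H) (E := E) (G := G)
  basisV _ _ weight highest) => //.
- by move=> u /(stable V subV LV)[].
- by move=> u /(stable V subV LV)[].
- by rewrite oppr_eq0 pnatr_eq0.
- by move=> u /(stable W subW LW)[].
- by move=> u /(stable W subW LW)[].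
- by move=> u /(stable W subW LW)[].
Qed.

(** A dimension count in an ambient space [T] that may be infinite-dimensional:
    [phi] embeds [V] into a space of dimension [n], so [n] independent vectors
    of [V] span it. *)
Lemma independent_spans (F : fieldType) (T : lmodType F) (vT : vectType F)
    (V : T -> Prop) (phi : {linear T -> vT}) n (b : 'I_n -> T) :
    subspace V -> (forall u, V u -> phi u = 0 -> u = 0) ->
    n = \dim {:vT} -> (forall i, V (b i)) ->
    (forall c : 'I_n -> F, \sum_i c i *: b i = 0 -> forall i, c i = 0) ->
  basis_of_subspace V b.
Proof.
move=> subV phi_inj n_dim Vb indep; split=> // u Vu.
have Vsum (c : 'I_n -> F) : V (\sum_i c i *: b i).
  by apply: (subspace_sum subV) => i; apply: (subspaceZ subV).
pose X := [tuple phi (b i) | i < n].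
have phi_sum (c : 'I_n -> F) : phi (\sum_i c i *: b i) = \sum_i c i *: X`_i.
  rewrite linear_sum; apply: eq_bigr => i _.
  by rewrite linearZ (nth_map i) ?size_enum_ord // nth_ord_enum.
have basisX : basis_of fullv X.
  rewrite basisEfree subvf size_tuple -n_dim leqnn !andbT.
  apply/freeP=> c; rewrite -phi_sum => /(phi_inj _ (Vsum c)).
  exact: indep.
exists (coord X ^~ (phi u)); apply/eqP; rewrite -subr_eq0; apply/eqP.
apply: phi_inj; first exact: (subspaceB subV).
by rewrite linearB phi_sum -(coord_basis basisX (memvf _)) subrr.
Qed.

Section WeightLines.
Variables (F : fieldType) (T : lmodType F) (h : Type).
Variable act : h -> T -> T.
Hypothesis actZ : forall X c u, act X (c *: u) = c *: act X u.

Definition line (b u : T) := exists c : F, u = c *: b.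

Lemma line_subspace b : subspace (line b).
Proof.
split=> [|a _ _ [c ->] [d ->]]; first by exists 0; rewrite scale0r.
by exists (a * c + d); rewrite scalerDl scalerA.
Qed.

Lemma eigenline_irreducible b :
  b != 0 -> (forall X, line b (act X b)) -> irreducible act (line b).
Proof.
move=> nzb eig; split.
- split=> [|X _ [c ->]]; first exact: line_subspace.
  by rewrite actZ; apply: (subspaceZ (line_subspace b)).
- by exists b => //; exists 1; rewrite scale1r.
move=> W [subW _] Wb.
have [[w Ww nzw]|W0] := pselect (exists2 w, W w & w != 0); last first.
  by left=> u Wu; apply/eqP/negP=> /negP nzu; apply: W0; exists u.
right=> _ [d ->]; have [c w_c] := Wb w Ww.
move: nzw; rewrite w_c scaler_eq0 negb_or => /andP[nzc _].
rewrite -[d](mulfVK nzc) -scalerA -w_c.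
exact: (subspaceZ subW).
Qed.

(** An isomorphism would carry [b] to an eigenvector with the same eigenvalue. *)
Lemma eigenline_not_isomorphic b b' X (lam lam' : F) :
    b != 0 -> act X b = lam *: b -> act X b' = lam' *: b' -> lam != lam' ->
  ~ isomorphic act (line b) (line b').
Proof.
move=> nzb eig eig' ne [phi [phiW phiL phi_inj _ phi_act]].
have lb : line b b by exists 1; rewrite scale1r.
have l0 : line b 0 by apply: (subspace0 (line_subspace b)).
have phi0 : phi 0 = 0.
  by have /eqP := phiL 1 0 0 l0 l0; rewrite scaler0 addr0 scale1r
    -subr_eq0 opprD addrA subrr sub0r oppr_eq0 => /eqP.
have [c phi_b] := phiW b lb.
have := phi_act X b lb.
rewrite eig -[lam *: b]addr0 phiL // phi0 addr0 phi_b actZ eig' !scalerA.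
rewrite -[lam * c]mulrC => /eqP; rewrite -subr_eq0 -scalerBl -mulrBr -scalerA.
have [c0 _|nzc] := eqVneq c 0.
  by case/eqP: nzb; apply: phi_inj lb _; rewrite phi_b c0 scale0r.
rewrite !scaler_eq0 (negbTE nzc) subr_eq0 (negbTE ne) /= => /eqP b'0.
by case/eqP: nzb; apply: phi_inj lb _; rewrite phi_b b'0 scaler0.
Qed.

Lemma basis_direct_sum V n (b : 'I_n -> T) :
  subspace V -> basis_of_subspace V b -> direct_sum V (fun i => line (b i)).
Proof.
move=> subV [Vb indep gen]; split.
- by move=> i _ [c ->]; apply: (subspaceZ subV).
- move=> u lu sum0 i.
  have [c u_c] := choice lu.
  have sumc : \sum_j c j *: b j = 0.
    by rewrite -[RHS]sum0; apply: eq_bigr => j _; rewrite u_c.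
  by rewrite u_c (indep c sumc) scale0r.
move=> v /gen[c ->]; exists (fun i => c i *: b i) => // i.
by exists (c i).
Qed.
End WeightLines.

(** * Rotations, Dirac operator and Cauchy-Kovalevskaya extension *)

(** Everything here follows from the commutation rules between the generators
    [e i], the central variables [x i] and the derivations [D i], so the algebra
    [A] is left abstract; it will be the algebra of Clifford-valued polynomials. *)
Section OperatorCalculus.
Variables (F : numFieldType) (A : algType F) (e x : 'I_3 -> A).
Variable D : 'I_3 -> {linear A -> A}.
Implicit Types (p q : A) (i j l : 'I_3).
Hypothesis ee : forall i j, e i * e j = - (e j * e i) - (i == j)%:R *+ 2.
Hypothesis xC : forall i p, x i * p = p * x i.
Hypothesis De : forall i j p, D i (e j * p) = e j * D i p.
Hypothesis Dx : forall i j p, D i (x j * p) = (i == j)%:R *: p + x j * D i p.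
Hypothesis DC : forall i j p, D i (D j p) = D j (D i p).

Definition spin_rot i j p : A :=
  (2^-1 *: (e i * e j)) * p + x j * D i p - x i * D j p.

(** The three families [e], [x] and [D] all rotate as the coordinates of a
    vector; this is their common infinitesimal variation under the rotation in
    the plane of [i] and [j]. *)
Definition vec_variation (V : 'I_3 -> A -> A) i j l p :=
  (l == j)%:R *: V i p - (l == i)%:R *: V j p.

Let xCA i p q : p * (x i * q) = x i * (p * q).
Proof. by rewrite mulrA -xC mulrA. Qed.

Fact spin_rot_linear i j : linear (spin_rot i j).
Proof.
move=> c p q; rewrite /spin_rot !linearP /= !mulrDr -!scalerAr.
rewrite scalerBr scalerDr opprD.
by rewrite [X in X + _ = _]addrACA [LHS]addrACA.
Qed.

HB.instance Definition _ i j :=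
  GRing.isLinear.Build F A A *:%R (spin_rot i j) (spin_rot_linear i j).

Lemma spin_rotD i j p q : spin_rot i j (p + q) = spin_rot i j p + spin_rot i j q.
Proof. exact: linearD. Qed.

Lemma spin_rotB i j p q : spin_rot i j (p - q) = spin_rot i j p - spin_rot i j q.
Proof. exact: linearB. Qed.

Lemma spin_rotZ i j c p : spin_rot i j (c *: p) = c *: spin_rot i j p.
Proof. exact: linearZ. Qed.

Lemma deriv_spin_rot i j l p :
  D l (spin_rot i j p) = spin_rot i j (D l p) + vec_variation D i j l p.
Proof.
rewrite /spin_rot /vec_variation linearB linearD -scalerAl linearZ /=.
rewrite -!mulrA !De !Dx (DC l i) (DC l j) mulrA scalerAl.
by rewrite opprD !addrA [LHS](ACl (1*3*5*2*4))/=.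
Qed.

Lemma var_spin_rot i j l p :
  x l * spin_rot i j p = spin_rot i j (x l * p)
    + vec_variation (fun i => *%R (x i)) i j l p.
Proof.
rewrite /spin_rot /vec_variation !Dx mulrBr !mulrDr -!scalerAr.
rewrite (eq_sym i l) (eq_sym j l) !opprD !(xCA l).
rewrite (xCA j (x l)) (xCA i (x l)).
by rewrite !addrA [RHS](ACl (1*3*5*((2*7)*(4*6)))) /= subrr addNr !addr0.
Qed.

Lemma gen_spin_rot i j l p :
  e l * spin_rot i j p = spin_rot i j (e l * p)
    + vec_variation (fun i => *%R (e i)) i j l p.
Proof.
rewrite /spin_rot /vec_variation !De mulrBr mulrDr !xCA [e l * (_ * p)]mulrA.
suff -> : e l * (2^-1 *: (e i * e j)) = (2^-1 *: (e i * e j)) * e l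
    + ((l == j)%:R *: e i - (l == i)%:R *: e j).
  rewrite !mulrDl mulNr -!scalerAl -!mulrA.
  by rewrite !addrA [RHS](ACl (1*4*5*2*3))/=.
have half (v : A) : 2^-1 *: (v *+ 2) = v.
  by rewrite -scaler_nat scalerA mulVf ?pnatr_eq0 // scale1r.
(* [e l] is moved across [e i], then across [e j]. *)
rewrite -scalerAr mulrA (ee l i) mulrBl mulNr -mulrA (ee l j).
rewrite mulrBr mulrN opprB opprK mulrA mulrnAr mulrnAl.
rewrite scalerBr scalerDr !half -scalerAl.
by rewrite !scaler_nat mulr_natr mulr_natl [X in X - _ = _]addrC !addrA.
Qed.

(** [spin_rot j l] is bilinear in vector families, so its commutator with
    [spin_rot i j] is obtained by varying each factor: the index [j] becomes
    [i], the index [l] is fixed, and the result is [- spin_rot i l]. *)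
Lemma spin_rot_comm i j l p : i != j -> j != l -> l != i ->
  spin_rot i j (spin_rot j l p) - spin_rot j l (spin_rot i j p) = spin_rot l i p.
Proof.
move=> ij jl li.
have Vj (V : 'I_3 -> A -> A) q : vec_variation V i j j q = V i q.
  by rewrite /vec_variation eqxx scale1r eq_sym (negbTE ij) scale0r subr0.
have Vl (V : 'I_3 -> A -> A) q : vec_variation V i j l q = 0.
  by rewrite /vec_variation eq_sym (negbTE jl) (negbTE li) !scale0r subr0.
have -> : spin_rot j l (spin_rot i j p) = spin_rot i j (spin_rot j l p) + spin_rot i l p.
  have -> : spin_rot j l (spin_rot i j p) = 2^-1 *: (e j * (e l * spin_rot i j p))
      + x l * D j (spin_rot i j p) - x j * D l (spin_rot i j p).
    by rewrite [LHS]/spin_rot -scalerAl mulrA.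
  have -> : spin_rot j l p = 2^-1 *: (e j * (e l * p)) + x l * D j p - x j * D l p.
    by rewrite [LHS]/spin_rot -scalerAl mulrA.
  have -> : spin_rot i l p = 2^-1 *: (e i * (e l * p)) + x l * D i p - x i * D l p.
    by rewrite [LHS]/spin_rot -scalerAl mulrA.
  rewrite spin_rotB spin_rotD spin_rotZ !deriv_spin_rot Vj Vl addr0 gen_spin_rot Vl addr0.
  rewrite gen_spin_rot Vj scalerDr mulrDr !var_spin_rot Vj Vl addr0.
  move: (spin_rot i j _) (spin_rot i j _) (spin_rot i j _) => u v w.
  by rewrite !opprD !addrA [LHS](ACl (1*3*5*2*4*6))/=.
rewrite opprD addrA subrr sub0r /spin_rot ee eq_sym (negbTE li) mul0rn subr0.
by rewrite scalerN mulNr !opprD !opprK addrAC.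
Qed.

Definition dirac123 p := e i1 * D i1 p + e i2 * D i2 p + e i3 * D i3 p.

(** The Dirac operator is the contraction of the vectors [e] and [D], hence
    rotation-invariant: the two variations cancel in the sum over [l]. *)
Lemma dirac_spin_rot i j p : dirac123 (spin_rot i j p) = spin_rot i j (dirac123 p).
Proof.
have dE q : dirac123 q = \sum_l e l * D l q.
  rewrite !big_ord_recl big_ord0 addr0 addrA.
  have -> : ord0 = i1 :> 'I_3 by apply: val_inj.
  have -> : lift i1 ord0 = i2 by apply: val_inj.
  by have -> : lift i1 (lift ord0 ord0) = i3 by apply: val_inj.
rewrite !dE linear_sum /=.
under eq_bigr => l _ do rewrite deriv_spin_rot mulrDr gen_spin_rot -addrA.
rewrite big_split /= -[RHS]addr0; congr (_ + _).
rewrite /vec_variation.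
under eq_bigr => l _ do rewrite mulrBr -!scalerAr.
rewrite big_split /= !sumrB.
have pick (f : 'I_3 -> A) k : \sum_l (l == k)%:R *: f l = f k.
  rewrite (bigD1 k) //= eqxx scale1r big1 ?addr0 // => l /negbTE->.
  by rewrite scale0r.
rewrite !pick.
by rewrite addrC addrA subrK subrr.
Qed.

Lemma gen_sqr i : e i * e i = -1.
Proof.
have half (u v : A) : u *+ 2 = v *+ 2 -> u = v.
  by rewrite -!scaler_nat => /scalerI; apply; rewrite pnatr_eq0.
by apply: half; rewrite mulr2n {2}ee eqxx addrA subrr sub0r mulNrn.
Qed.

Definition dirac12 p := e i1 * D i1 p + e i2 * D i2 p.
(** The generator of the Cauchy-Kovalevskaya extension: by [monogenicP], the
    Dirac equation is the evolution equation [D i3 p = ckop p] in the third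
    variable, solved by the exponential of [x i3] times this operator. *)
Definition ckop p := e i3 * dirac12 p.
(** Truncated at [k], which loses nothing on planar polynomials of degree [k]. *)
Definition ckexp k p :=
  \sum_(s < k.+1) (s`!%:R^-1 : F) *: (x i3 ^+ s * iter s ckop p).

Fact ckop_linear : linear ckop.
Proof.
move=> c p q; rewrite /ckop /dirac12 !linearP /= !mulrDr -!scalerAr.
by rewrite scalerDr addrACA.
Qed.
HB.instance Definition _ := GRing.isLinear.Build F A A *:%R ckop ckop_linear.

Lemma ckopZ c p : ckop (c *: p) = c *: ckop p.
Proof. exact: linearZ. Qed.

(** Only bivectors occur, so [ckop] acts on spinor-valued functions although the
    vector [e i3] does not act on spinors. *)
Lemma ckop_bivector p : ckop p = (e i3 * e i1) * D i1 p + (e i3 * e i2) * D i2 p.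
Proof. by rewrite /ckop /dirac12 mulrDr !mulrA. Qed.

Lemma dirac_ckop p : e i3 * dirac123 p = ckop p - D i3 p.
Proof. by rewrite /dirac123 mulrDr mulrA gen_sqr mulN1r. Qed.

(** Multiplication by [e i3] is invertible. *)
Lemma monogenicP p : dirac123 p = 0 <-> D i3 p = ckop p.
Proof.
split=> [dp|Dp]; first by apply/eqP; rewrite -subr_eq0 -opprB -dirac_ckop dp mulr0 oppr0.
have -> : dirac123 p = - (e i3 * (e i3 * dirac123 p)).
  by rewrite mulrA gen_sqr mulN1r opprK.
by rewrite dirac_ckop Dp subrr mulr0 oppr0.
Qed.

(** The rotation in the plane of [i1] and [i2] fixes [e i3] and [D i3] and commutes
    with the full Dirac operator, hence with its planar part. *)
Lemma spin_rot_ckop p : spin_rot i1 i2 (ckop p) = ckop (spin_rot i1 i2 p).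
Proof.
have vv (V : 'I_3 -> A -> A) q : vec_variation V i1 i2 i3 q = 0.
  by rewrite /vec_variation !scale0r subr0.
have E q : dirac12 q = dirac123 q - e i3 * D i3 q by rewrite /dirac123 addrK.
have spin_rot_e3 q : spin_rot i1 i2 (e i3 * q) = e i3 * spin_rot i1 i2 q.
  by rewrite gen_spin_rot vv addr0.
have spin_rot_d q : spin_rot i1 i2 (dirac12 q) = dirac12 (spin_rot i1 i2 q).
  by rewrite !E spin_rotB -dirac_spin_rot deriv_spin_rot vv addr0 spin_rot_e3.
by rewrite [LHS]spin_rot_e3 spin_rot_d.
Qed.

Lemma spin_rot_ckexp k p : spin_rot i1 i2 (ckexp k p) = ckexp k (spin_rot i1 i2 p).
Proof.
rewrite /ckexp linear_sum /=; apply: eq_bigr => s _; rewrite spin_rotZ.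
have spin_rotX q : spin_rot i1 i2 (x i3 ^+ s * q) = x i3 ^+ s * spin_rot i1 i2 q.
  elim: (nat_of_ord s) => [|r IHr]; first by rewrite !mul1r.
  rewrite exprS -!mulrA -IHr var_spin_rot /vec_variation.
  by rewrite !scale0r subr0 addr0.
congr (_ *: _); rewrite spin_rotX; congr (_ * _).
by elim: (nat_of_ord s) => //= r IHr; rewrite spin_rot_ckop IHr.
Qed.

Lemma deriv_ckop p : D i3 (ckop p) = ckop (D i3 p).
Proof.
by rewrite /ckop /dirac12 De linearD /= !De (DC i3 i1) (DC i3 i2).
Qed.

Lemma ckop_var p : ckop (x i3 * p) = x i3 * ckop p.
Proof. by rewrite /ckop /dirac12 !Dx !scale0r !add0r !xCA -mulrDr xCA. Qed.

(** Differentiating term by term shifts the exponential series by one index, as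
    does [ckop], since [ckop] commutes with [x i3]; the term where the truncation
    could make a difference is the one killed by nilpotency. *)
Lemma ckexp_monogenic k p :
  D i3 p = 0 -> iter k.+1 ckop p = 0 -> dirac123 (ckexp k p) = 0.
Proof.
move=> D3p nilp; apply/monogenicP.
have D3 s : D i3 (iter s ckop p) = 0.
  by elim: s => //= s IHs; rewrite deriv_ckop IHs linear0.
have DX s q : D i3 q = 0 -> D i3 (x i3 ^+ s * q) = s%:R *: (x i3 ^+ s.-1 * q).
  move=> Dq; elim: s => [|s IHs]; first by rewrite mul1r Dq scale0r.
  rewrite exprS -mulrA Dx scale1r IHs -scalerAr -natr1 scalerDl scale1r addrC.
  by case: s {IHs} => [|s]; rewrite ?scale0r // mulrA -exprS.
have ckX s q : ckop (x i3 ^+ s * q) = x i3 ^+ s * ckop q.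
  elim: s => [|s IHs]; first by rewrite !mul1r.
  by rewrite exprS -!mulrA ckop_var IHs.
rewrite /ckexp !linear_sum /= big_ord_recl [RHS]big_ord_recr /=.
rewrite [X in _ = _ + X]linearZ /= ckX -iterS nilp mulr0 scaler0 addr0.
rewrite linearZ /= mul1r D3p scaler0 add0r; apply: eq_bigr => s _.
rewrite linearZ ckopZ ckX DX; last exact: (D3 s.+1).
rewrite /= scalerA /bump add1n; congr (_ *: _).
by rewrite factS natrM invfM mulrAC mulVf ?mul1r // pnatr_eq0.
Qed.

Lemma deriv3_planar c p :
  D i3 p = 0 -> D i3 (x i1 * p + c *: (x i2 * p)) = 0.
Proof.
move=> Dp; rewrite linearD linearZ /= !Dx Dp.
by rewrite !mulr0 !scale0r !addr0 scaler0 addr0.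
Qed.

Variable I : F.
Hypothesis II : I * I = -1.
Definition weight_vector (mu : F) p := - I *: spin_rot i1 i2 p = mu *: p.

Lemma weight_ckexp mu k p :
  weight_vector mu p -> weight_vector mu (ckexp k p).
Proof.
have ckexpZ c q : ckexp k (c *: q) = c *: ckexp k q.
  rewrite /ckexp scaler_sumr; apply: eq_bigr => s _.
  rewrite scalerA mulrC -scalerA; congr (_ *: _); rewrite scalerAr.
  congr (_ * _).
  by elim: (nat_of_ord s) => //= r ->; rewrite ckopZ.
by rewrite /weight_vector spin_rot_ckexp -!ckexpZ => ->.
Qed.

Lemma weight_scale mu c p : weight_vector mu p -> weight_vector mu (c *: p).
Proof.
rewrite /weight_vector spin_rotZ scalerA mulrC -scalerA => ->.
by rewrite !scalerA mulrC.
Qed.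

Let spin_rot_var (c : F) p : spin_rot i1 i2 ((x i1 + c *: x i2) * p) =
  (x i1 + c *: x i2) * spin_rot i1 i2 p + x i2 * p - c *: (x i1 * p).
Proof.
have r1 : x i1 * spin_rot i1 i2 p = spin_rot i1 i2 (x i1 * p) - x i2 * p.
  by rewrite var_spin_rot /vec_variation /= scale0r scale1r sub0r.
have r2 : x i2 * spin_rot i1 i2 p = spin_rot i1 i2 (x i2 * p) + x i1 * p.
  by rewrite var_spin_rot /vec_variation /= scale0r scale1r subr0.
rewrite !mulrDl -!scalerAl spin_rotD spin_rotZ r1 r2.
move: (spin_rot _ _ (x i1 * p)) (spin_rot _ _ (x i2 * p)) => u v.
by rewrite scalerDr !addrA [RHS](ACl (1*3*((2*5)*(4*6)))) /= addNr subrr !addr0.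
Qed.

Lemma weight_z mu p :
  weight_vector mu p -> weight_vector (mu - 1) ((x i1 + I *: x i2) * p).
Proof.
rewrite /weight_vector spin_rot_var => wp.
rewrite -addrA scalerDr scalerAr wp -scalerAr scalerBl scale1r; congr (_ + _).
rewrite scalerBr scalerA mulNr II opprK scale1r mulrDl -scalerAl scaleNr.
by rewrite opprD addrC.
Qed.

Lemma weight_zbar mu p :
  weight_vector mu p -> weight_vector (mu + 1) ((x i1 - I *: x i2) * p).
Proof.
rewrite /weight_vector -scaleNr spin_rot_var => wp.
rewrite -addrA scalerDr scalerAr wp -scalerAr scalerDl scale1r; congr (_ + _).
rewrite scalerBr scalerA mulrNN II scaleN1r opprK mulrDl -scalerAl scaleNr.
by rewrite addrC.
Qed.

Lemma weight_const mu v :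
    (forall i, D i v = 0) -> - I *: (e i1 * e i2 * v) = mu *: v ->
  weight_vector (mu / 2) v.
Proof.
move=> Dv ev; rewrite /weight_vector /spin_rot !Dv !mulr0 subr0 addr0.
by rewrite -scalerAl scalerA mulrC -scalerA ev scalerA mulrC.
Qed.

Lemma weight_monomial mu (j l : nat) v : weight_vector mu v ->
  weight_vector (mu + l%:R - j%:R)
    ((x i1 + I *: x i2) ^+ j * (x i1 - I *: x i2) ^+ l * v).
Proof.
move=> wv; rewrite -mulrA; elim: j => [|j IHj]; last first.
  by rewrite exprS -mulrA -natr1 opprD addrA; apply: weight_z.
rewrite subr0 mul1r.
elim: l => [|l IHl].
  by rewrite addr0 mul1r.
by rewrite exprS -mulrA -natr1 addrA; apply: weight_zbar.
Qed.
End OperatorCalculus.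

(** * Clifford-valued polynomials in three variables *)

Section ClPolyAlgebra.
Variables (F : fieldType) (n : nat).
Local Notation P3 := (clpoly F n).

Lemma clpoly_scaleE c (p : P3) : c *: p = (c%:A : clifford F n)%:MP * p.
Proof. by []. Qed.

Lemma mcoeff_clpoly_scale c (p : P3) m : (c *: p)@_m = c *: p@_m.
Proof. by rewrite clpoly_scaleE mcoeffCM -scalerAl mul1r. Qed.

Fact clpoly_scaleAl c (p q : P3) : c *: (p * q) = (c *: p) * q.
Proof. by rewrite !clpoly_scaleE mulrA. Qed.

HB.instance Definition _ := GRing.Lmodule_isLalgebra.Build F P3 clpoly_scaleAl.

(** The scalars of [F] are central in the Clifford algebra. *)
Fact clpoly_scaleAr c (p q : P3) : c *: (p * q) = p * (c *: q).
Proof.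
rewrite !clpoly_scaleE !mulrA; congr (_ * q); apply/mpolyP=> m.
rewrite mcoeffM mcoeffMr; apply: eq_bigr => k _.
rewrite mcoeffC; case: (_ == _); rewrite ?mulr0 ?mul0r // mulr1.
by rewrite -scalerAl -scalerAr mul1r mulr1.
Qed.

HB.instance Definition _ := GRing.Lalgebra_isAlgebra.Build F P3 clpoly_scaleAr.
End ClPolyAlgebra.

Section Operators.
Variables (R : realType) (m : nat).
Local Notation C := R[i].
Local Notation Cl := (clifford C (3 + m)).
Local Notation P3 := (clpoly C (3 + m)).
Local Notation I := ('i%C : C).
Local Notation x i := (xvar R m i).
Local Notation D i := (@pderiv R m i).
Local Notation e i := (cst (evec R m i)).
Implicit Types (p q : P3) (a : Cl) (i j l : 'I_3).

Lemma cstM a b : cst (a * b) = cst a * cst b.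
Proof. exact: mpolyCM. Qed.

Lemma cstZ c a : cst (c *: a) = c *: cst a :> P3.
Proof. by rewrite clpoly_scaleE -mpolyCM -scalerAl mul1r. Qed.

Lemma xvarC i p : x i * p = p * x i.
Proof. exact/esym/commr_mpolyX. Qed.

Fact pderiv_linear i : linear (D i).
Proof.
by move=> c p q; rewrite /pderiv clpoly_scaleE mderivD mderiv_mulC.
Qed.

HB.instance Definition _ i :=
  GRing.isLinear.Build C P3 P3 *:%R (D i) (pderiv_linear i).

Lemma pderiv_cst i a p : D i (cst a * p) = cst a * D i p.
Proof. exact: mderiv_mulC. Qed.

Lemma pderiv_xvar i j p : D i (x j * p) = (i == j)%:R *: p + x j * D i p.
Proof.
have Dx : D i (x j) = (i == j)%:R.
  rewrite /pderiv mderivX mnm1E eq_sym.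
  case: eqP => [->|_]; last by rewrite scale0r.
  rewrite scale1r (_ : U_(j) - U_(j) = 0)%MM ?mpolyX0 //.
  by apply/mnmP=> l; rewrite mnmBE subnn mnm0E.
have -> : D i (x j * p) = D i (x j) * p + x j * D i p by exact: mderivM.
rewrite Dx; case: (_ == _); first by rewrite mul1r scale1r.
by rewrite mul0r scale0r.
Qed.

Lemma pderivC i j p : D i (D j p) = D j (D i p).
Proof. exact: mderiv_comm. Qed.

Lemma evec_mul i j :
  e i * e j = - (e j * e i) - (i == j)%:R *+ 2 :> P3.
Proof.
rewrite -!cstM.
have [->|ij] := eqVneq.
  by rewrite clgen_sqr /cst mpolyCN mpolyC1 opprK mulr2n opprD addrA subrr sub0r.
by rewrite mul0rn subr0 clgen_anticomm ?(inj_eq (@lshift_inj _ _)) // /cst mpolyCN.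
Qed.

Local Notation D' := (fun i => D i : {linear P3 -> P3}).
Local Notation e' := (fun i => e i : P3).

Lemma LopE i j p : Lop i j p = spin_rot e' (xvar R m) D' i j p.
Proof. by rewrite /Lop cstZ cstM. Qed.

Lemma diracE p : dirac p = dirac123 e' D' p. Proof. by []. Qed.

Fact Lop_linear i j : linear (@Lop R m i j).
Proof. by move=> c p q; rewrite !LopE linearP. Qed.

HB.instance Definition _ i j :=
  GRing.isLinear.Build C P3 P3 *:%R (@Lop R m i j) (Lop_linear i j).

Lemma Lop_comm i j l p : i != j -> j != l -> l != i ->
  Lop i j (Lop j l p) - Lop j l (Lop i j p) = Lop l i p.
Proof.
rewrite !LopE; apply: spin_rot_comm.
- exact: evec_mul.
- exact: xvarC.
- by move=> *; apply: pderiv_cst.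
- exact: pderiv_xvar.
- exact: pderivC.
Qed.

Lemma dirac_Lop i j p : dirac (Lop i j p) = Lop i j (dirac p).
Proof.
rewrite !LopE !diracE; apply: dirac_spin_rot.
- exact: evec_mul.
- exact: xvarC.
- by move=> *; apply: pderiv_cst.
- exact: pderiv_xvar.
- exact: pderivC.
Qed.

Lemma mcoeff_xvar i p mon :
  (x i * p)@_mon = if mon i == 0%N then 0 else p@_(mon - U_(i)).
Proof.
case: eqP => [m0|/eqP mi].
  rewrite mcoeffM big1 // => k /eqP mon_k; rewrite mcoeffX.
  case: eqP => [k1|_]; last by rewrite mul0r.
  have := congr1 (fun mon' : 'X_{1..3} => mon' i) mon_k.
  by rewrite m0 mnmDE -k1 mnm1E eqxx.
by rewrite xvarC -{1}(@submK _ U_(i)%MM mon) ?lep1mP // addmC mcoeffMX.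
Qed.

Lemma mcoeff_pderiv i p mon : (D i p)@_mon = p@_(mon + U_(i)) *+ (mon i).+1.
Proof. exact: mcoeff_mderiv. Qed.

Lemma mcoeff_cst a p mon : (cst a * p)@_mon = a * p@_mon.
Proof. exact: mcoeffCM. Qed.

Lemma mcoeff_add p q mon : (p + q)@_mon = p@_mon + q@_mon.
Proof. exact: mcoeffD. Qed.

Lemma mcoeff_sum n (f : 'I_n -> P3) mon : (\sum_i f i)@_mon = \sum_i (f i)@_mon.
Proof. exact: (big_morph (mcoeff mon) (mcoeffD mon) (mcoeff0 _ mon)). Qed.

Lemma mcoeff_lin c p q mon : (p + c *: q)@_mon = p@_mon + c *: q@_mon.
Proof. by rewrite mcoeff_add mcoeff_clpoly_scale. Qed.

Lemma mcoeff_ckop p mon : (ckop e' D' p)@_mon =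
  evec R m i3 * (evec R m i1 * (p@_(mon + U_(i1)) *+ (mon i1).+1)
                 + evec R m i2 * (p@_(mon + U_(i2)) *+ (mon i2).+1)).
Proof.
rewrite /ckop /dirac12.
rewrite [LHS](mcoeff_cst (evec R m i3)).
rewrite [X in _ * X]mcoeff_add.
congr (_ * (_ + _)).
  rewrite [LHS]mcoeff_cst.
  congr (_ * _).
  exact: mcoeff_pderiv.
rewrite [LHS]mcoeff_cst.
congr (_ * _).
exact: mcoeff_pderiv.
Qed.

(** Uniqueness in the Cauchy-Kovalevskaya extension. The equation
    [D i3 p = ckop p] expresses the coefficients of exponent [d.+1] in the third
    variable through those of exponent [d], because [ckop] does not touch that
    variable; so all of them vanish by induction on [d]. *)
Lemma monogenic_planar_uniq p : dirac p = 0 ->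
  (forall mon : 'X_{1..3}, mon i3 = 0%N -> p@_mon = 0) -> p = 0.
Proof.
move=> dp p0; apply/mpolyP=> mon; rewrite mcoeff0.
move: {2}(mon i3) (erefl (mon i3)) => d.
elim: d mon => [|d IHd] mon mon3; first exact: p0.
have D3p : D i3 p = ckop e' D' p by apply/(monogenicP D' evec_mul).
have U3 : (U_(i3) <= mon)%MM by rewrite lep1mP mon3.
have mon'3 : (mon - U_(i3))%MM i3 = d by rewrite mnmBE mnm1E eqxx mon3 subn1.
have := congr1 (mcoeff (mon - U_(i3))%MM) D3p.
rewrite mcoeff_pderiv submK // mcoeff_ckop.
rewrite !(IHd (_ + _)%MM) ?mnmDE ?mon'3 ?mnm1E ?addn0 //.
rewrite !mul0rn !mulr0 addr0 mulr0 => /eqP.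
by rewrite -scaler_nat scaler_eq0 pnatr_eq0 /= => /eqP.
Qed.

Lemma homogP k p :
  p \is k.-homog <-> forall mon, mdeg mon != k -> p@_mon = 0.
Proof.
split=> [hp mon|hp]; first exact: dhomog_nemf_coeff.
apply/dhomogP=> mon; rewrite mcoeff_msupp => nz.
by apply/eqP; apply: contraNT nz => /hp->.
Qed.

Lemma homog_pderiv k i p : p \is k.-homog -> D i p \is k.-1.-homog.
Proof.
move=> /homogP hp; apply/homogP=> mon mk; rewrite mcoeff_pderiv hp ?mul0rn //.
by rewrite mdegD mdeg1 addn1; apply: contraNneq mk => <-.
Qed.

Lemma homog0_pderiv i p : p \is 0.-homog -> D i p = 0.
Proof.
move=> /homogP hp; apply/mpolyP=> mon; rewrite mcoeff_pderiv mcoeff0.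
by rewrite hp ?mul0rn // mdegD mdeg1 addn1.
Qed.

Lemma homog_xvar k i p : p \is k.-homog -> x i * p \is k.+1.-homog.
Proof.
move=> hp; rewrite -[k.+1]add1n; apply: dhomogM hp.
by rewrite dhomogX /= mdeg1.
Qed.

Lemma homog_cst k a p : p \is k.-homog -> cst a * p \is k.-homog.
Proof.
move=> /homogP hp; apply/homogP=> mon mk.
by rewrite mcoeff_cst hp // mulr0.
Qed.

Lemma homog_scale k c p : p \is k.-homog -> c *: p \is k.-homog.
Proof. by rewrite clpoly_scaleE; apply: homog_cst. Qed.

Lemma homog_xpderiv k i j p : p \is k.-homog -> x i * D j p \is k.-homog.
Proof.
case: k => [|k] hp; first by rewrite homog0_pderiv // mulr0 rpred0.
exact/homog_xvar/(homog_pderiv _ hp).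
Qed.

Lemma homog_add k p q : p \is k.-homog -> q \is k.-homog -> p + q \is k.-homog.
Proof. exact: rpredD. Qed.

Lemma homog_Lop k i j p : p \is k.-homog -> Lop i j p \is k.-homog.
Proof.
move=> hp; apply: rpredB; last exact: homog_xpderiv.
by apply: rpredD; [apply: homog_cst | apply: homog_xpderiv].
Qed.

Definition Svalued (S : {vspace Cl}) p := forall mon, p@_mon \in S.

Section SpinorValued.
Variable S : {vspace Cl}.
Hypothesis spinorS : basic_spinor S.

(** A product of two basis vectors is an element of Spin(3). *)
Lemma spinor_bivector i j u : u \in S -> evec R m i * evec R m j * u \in S.
Proof.
have [_ stable] := spinorS; apply: stable.
have vec l : vec3 m (delta_mx 0 l) = evec R m l.
  rewrite /vec3 (bigD1 l) //= big1 => [|l' l'l]; last first.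
    by rewrite mxE (negbTE l'l) andbF /= scale0r.
  by rewrite mxE !eqxx /= scale1r addr0.
have unit_vec l : \sum_l' (delta_mx 0 l : 'rV[R]_3) 0 l' ^+ 2 = 1.
  rewrite (bigD1 l) //= big1 => [|l' l'l]; last first.
    by rewrite mxE (negbTE l'l) andbF expr0n.
  by rewrite mxE !eqxx expr1n addr0.
exists [:: delta_mx 0 i; delta_mx 0 j]; split=> //.
  by move=> v; rewrite !inE => /orP[]/eqP->.
by rewrite !big_cons big_nil mulr1 !vec.
Qed.

Lemma Svalued_add p q : Svalued S p -> Svalued S q -> Svalued S (p + q).
Proof. by move=> Sp Sq mon; rewrite mcoeff_add rpredD. Qed.

Lemma Svalued_scale c p : Svalued S p -> Svalued S (c *: p).
Proof. by move=> Sp mon; rewrite mcoeff_clpoly_scale rpredZ. Qed.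

Lemma Svalued_opp p : Svalued S p -> Svalued S (- p).
Proof. by rewrite -scaleN1r; apply: Svalued_scale. Qed.

Lemma Svalued_pderiv i p : Svalued S p -> Svalued S (D i p).
Proof. by move=> Sp mon; rewrite mcoeff_pderiv rpredMn. Qed.

Lemma Svalued_xvar i p : Svalued S p -> Svalued S (x i * p).
Proof. by move=> Sp mon; rewrite mcoeff_xvar; case: ifP; rewrite ?rpred0. Qed.

Lemma Svalued_bivector i j p :
  Svalued S p -> Svalued S (cst (evec R m i * evec R m j) * p).
Proof. by move=> Sp mon; rewrite mcoeff_cst; apply/spinor_bivector/Sp. Qed.

Lemma Svalued_Lop i j p : Svalued S p -> Svalued S (Lop i j p).
Proof.
move=> Sp; rewrite /Lop cstZ -scalerAl.
apply: Svalued_add; last exact/Svalued_opp/Svalued_xvar/Svalued_pderiv.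
apply: Svalued_add; last exact/Svalued_xvar/Svalued_pderiv.
exact/Svalued_scale/Svalued_bivector.
Qed.

Lemma monogenic_subspace k : subspace (monogenic k S).
Proof.
split.
  split=> [mon||]; first by rewrite mcoeff0 rpred0.
    exact: rpred0.
  by apply/(monogenicP D' evec_mul); rewrite !linear0.
move=> c p q [Sp hp dp] [Sq hq dq]; split.
- exact/Svalued_add/Sq/Svalued_scale.
- exact/homog_add/hq/homog_scale.
apply/(monogenicP D' evec_mul); rewrite !linearP /=.
by move/(monogenicP D' evec_mul): dp => ->; move/(monogenicP D' evec_mul): dq => ->.
Qed.

Lemma monogenic_Lop k i j p : monogenic k S p -> monogenic k S (Lop i j p).
Proof.
move=> [Sp hp dp]; split; [exact: Svalued_Lop | exact: homog_Lop |].
by rewrite dirac_Lop dp linear0.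
Qed.

End SpinorValued.
End Operators.

(** * Extensions of the planar monomials *)

Section Extensions.
Variables (R : realType) (m : nat).
Local Notation C := R[i].
Local Notation Cl := (clifford C (3 + m)).
Local Notation P3 := (clpoly C (3 + m)).
Local Notation I := ('i%C : C).
Local Notation x i := (xvar R m i).
Local Notation D i := (@pderiv R m i).
Local Notation e i := (cst (evec R m i)).
Implicit Types (p q : P3) (a : Cl) (i j l : 'I_3).
Local Notation D' := (fun i => D i : {linear P3 -> P3}).
Local Notation e' := (fun i => e i : P3).
Local Notation x' := (xvar R m).

Definition planar_monomial (r s : nat) (v : Cl) : P3 :=
  zpoly R m ^+ r * zbarpoly R m ^+ s * cst v.

(** A planar monomial is reached from a constant by factors of the form
    [x i1 + c *: x i2], with [c] equal to plus or minus the imaginary unit. *)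
Lemma planar_monomial_ind (P : nat -> P3 -> Prop) (v : Cl) :
    P 0%N (cst v) ->
    (forall c d q, P d q -> P d.+1 (x i1 * q + c *: (x i2 * q))) ->
  forall r s, P (r + s)%N (planar_monomial r s v).
Proof.
move=> P0 PS r s; rewrite /planar_monomial -mulrA.
have step c d q : P d q -> P d.+1 ((x i1 + c *: x i2) * q).
  by move=> Pq; rewrite mulrDl -scalerAl; apply: PS.
elim: r => [|r IHr]; last by rewrite exprS -mulrA addSn; apply: step.
rewrite mul1r add0n; elim: s => [|s IHs]; first by rewrite mul1r.
have -> : zbarpoly R m = x i1 + - I *: x i2 by rewrite scaleNr.
by rewrite exprS -mulrA; apply: step; rewrite scaleNr.
Qed.

Lemma homog_planar r s v : planar_monomial r s v \is (r + s).-homog.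
Proof.
apply: (planar_monomial_ind (P := fun d q => q \is d.-homog)) => [|c d q hq].
  by rewrite -[cst v]mulr1; apply: homog_cst; apply: dhomog1.
by apply: homog_add; [|apply: homog_scale]; apply: homog_xvar.
Qed.

Lemma pderiv3_planar r s v : D i3 (planar_monomial r s v) = 0.
Proof.
apply: (planar_monomial_ind (P := fun=> fun q => D i3 q = 0)) => [|c _ q Dq].
  exact: mderivC.
exact: (@deriv3_planar _ P3 x' D' (@pderiv_xvar R m) c q Dq).
Qed.

(** Each linear factor has coefficient 1 at [x i1], whence the coefficient of the
    pure power of [x i1]; it is the witness that the extension is nonzero. *)
Lemma mcoeff_planar r s v :
  (planar_monomial r s v)@_(U_(i1) *+ (r + s)) = v.
Proof.
apply: (planar_monomial_ind (P := fun d q => q@_(U_(i1) *+ d) = v)) => [|c d q qv].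
  by rewrite mulm0n mcoeffC eqxx mulr1.
have m2 : (U_(i1) *+ d.+1)%MM i2 = 0%N by rewrite mulmnE mnm1E mul0n.
have m1 : (U_(i1) *+ d.+1)%MM i1 = d.+1 by rewrite mulmnE mnm1E mul1n.
have E1 : (x i1 * q)@_(U_(i1) *+ d.+1) = v.
  by rewrite mcoeff_xvar m1 /= mulmS addmC addmK.
have E2 : (x i2 * q)@_(U_(i1) *+ d.+1) = 0 by rewrite mcoeff_xvar m2.
move: (x i1 * q) (x i2 * q) E1 E2 => q1 q2 E1 E2.
by rewrite mcoeff_lin E1 E2 scaler0 addr0.
Qed.

Lemma Svalued_planar (S : {vspace Cl}) r s v :
  v \in S -> Svalued S (planar_monomial r s v).
Proof.
move=> Sv; apply: (planar_monomial_ind (P := fun=> Svalued S)) => [mon|c _ q Sq].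
  by rewrite mcoeffC; case: (_ == _); rewrite ?mulr1 ?mulr0 ?rpred0.
by apply: Svalued_add; [|apply: Svalued_scale]; apply: Svalued_xvar.
Qed.

Local Notation ck := (ckop e' D').

Lemma homog_ckop k p : p \is k.-homog -> ck p \is k.-1.-homog.
Proof.
move=> hp; apply: homog_cst.
by apply: homog_add; apply/homog_cst/homog_pderiv.
Qed.

Lemma homog_iter_ckop k p s : p \is k.-homog -> iter s ck p \is (k - s).-homog.
Proof.
move=> hp; elim: s => [|s IHs]; first by rewrite subn0.
by rewrite subnS /=; apply: homog_ckop.
Qed.

Lemma ckop_nilpotent k p : p \is k.-homog -> iter k.+1 ck p = 0.
Proof.
move=> /(homog_iter_ckop k); rewrite subnn iterS => h0.
rewrite /ckop /dirac12 /= (homog0_pderiv i1 h0) (homog0_pderiv i2 h0).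
by rewrite !mulr0 addr0 mulr0.
Qed.

Lemma homog_ckexp k p : p \is k.-homog -> ckexp e' x' D' k p \is k.-homog.
Proof.
move=> hp; apply: rpred_sum => s _; apply: homog_scale.
have sk : (s <= k)%N by rewrite -ltnS.
have hX r d q : q \is d.-homog -> x i3 ^+ r * q \is (r + d).-homog.
  move=> hq; elim: r => [|r IHr]; first by rewrite mul1r.
  by rewrite exprS -mulrA (addSn r); apply: homog_xvar.
by have := hX s _ _ (homog_iter_ckop s hp); rewrite subnKC.
Qed.

Lemma Svalued_ckexp (S : {vspace Cl}) k p :
  basic_spinor S -> Svalued S p -> Svalued S (ckexp e' x' D' k p).
Proof.
move=> spS Sp; rewrite /ckexp.
apply: (big_ind (Svalued S)) => [mon||s _].
- by rewrite mcoeff0 rpred0.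
- exact: Svalued_add.
apply: Svalued_scale.
have Sck q : Svalued S q -> Svalued S (ck q).
  move=> Sq.
  have -> : ck q = cst (evec R m i3 * evec R m i1) * D i1 q
                   + cst (evec R m i3 * evec R m i2) * D i2 q.
    by rewrite !cstM; apply: ckop_bivector.
  by apply: Svalued_add; apply: (Svalued_bivector spS); apply: Svalued_pderiv.
have Sit : Svalued S (iter s ck p).
  by elim: (nat_of_ord s) => //= r IHr; apply: Sck.
elim: (nat_of_ord s) (iter _ _ _) Sit => [|r IHr] q Sq; first by rewrite mul1r.
by rewrite exprS -mulrA; apply/Svalued_xvar/IHr.
Qed.

Lemma mcoeff_ckexp k p (mon : 'X_{1..3}) :
  mon i3 = 0%N -> (ckexp e' x' D' k p)@_mon = p@_mon.
Proof.
move=> mon3; rewrite /ckexp mcoeff_sum big_ord_recl.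
rewrite big1 => [|s _].
  by rewrite addr0 mcoeff_clpoly_scale /= invr1 scale1r mul1r.
rewrite mcoeff_clpoly_scale.
by rewrite lift0 exprS -mulrA mcoeff_xvar mon3 scaler0.
Qed.

Lemma gt_polyE k r v :
  gt_poly k r v = ckexp e' x' D' k
    ((r`! * (k - r)`!)%:R^-1 *: planar_monomial r (k - r) v).
Proof. by []. Qed.

Lemma gt_poly_monogenic (S : {vspace Cl}) k r v :
  basic_spinor S -> (r <= k)%N -> v \in S -> monogenic k S (gt_poly k r v).
Proof.
move=> spS rk Sv; rewrite gt_polyE; set c := _^-1.
have hp : c *: planar_monomial r (k - r) v \is k.-homog.
  by apply: homog_scale; have := homog_planar r (k - r) v; rewrite subnKC.
split; first exact/(Svalued_ckexp _ spS)/Svalued_scale/Svalued_planar.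
  exact: homog_ckexp.
apply: (@ckexp_monogenic _ P3 e' x' D').
- exact: evec_mul.
- exact: xvarC.
- by move=> *; apply: pderiv_cst.
- exact: pderiv_xvar.
- exact: pderivC.
- by rewrite linearZ /= pderiv3_planar scaler0.
- exact: ckop_nilpotent.
Qed.

Lemma gt_poly_weight k r (mu : C) v : (r <= k)%N ->
    - I *: (evec R m i1 * evec R m i2 * v) = mu *: v ->
  Hop (gt_poly k r v) = (mu / 2 + k%:R - (2 * r)%:R) *: gt_poly k r v.
Proof.
move=> rk eig.
have II : I * I = -1 by rewrite -expr2 sqr_i.
rewrite /Hop LopE gt_polyE.
have -> : mu / 2 + k%:R - (2 * r)%:R = mu / 2 + (k - r)%:R - r%:R.
  by rewrite natrB // natrM; ring.
apply: (@weight_ckexp _ P3 e' x' D').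
- exact: evec_mul.
- exact: xvarC.
- by move=> *; apply: pderiv_cst.
- exact: pderiv_xvar.
- exact: pderivC.
apply: weight_scale.
apply: (@weight_monomial _ P3 e' x' D').
- exact: xvarC.
- exact: pderiv_xvar.
- exact: II.
apply: weight_const.
  by move=> i; exact: mderivC.
rewrite -!cstM -!cstZ; congr cst.
exact: eig.
Qed.

Lemma gt_poly_neq0 k r (v : Cl) : (r <= k)%N -> v != 0 -> gt_poly k r v != 0.
Proof.
move=> rk; apply: contraNneq => gt0.
have : (gt_poly k r v)@_(U_(i1) *+ k) = 0 by rewrite gt0 mcoeff0.
rewrite gt_polyE mcoeff_ckexp ?mulmnE ?mnm1E ?mul0n //.
rewrite mcoeff_clpoly_scale -{2}(subnKC rk) mcoeff_planar => /eqP.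
by rewrite scaler_eq0 invr_eq0 pnatr_eq0 gtn_eqF ?muln_gt0 ?fact_gt0 // => /eqP.
Qed.

Section Spinor.
Variable S : {vspace Cl}.
Hypothesis spinorS : basic_spinor S.

Let II : I * I = -1. Proof. by rewrite -expr2 sqr_i. Qed.

Let E i j := evec R m i * evec R m j.

Let evec_anticomm i j : i != j -> E i j = - E j i.
Proof. by move=> ij; rewrite /E clgen_anticomm // (inj_eq (@lshift_inj _ _)). Qed.

Let evec_sqr i : evec R m i * evec R m i = -1.
Proof. exact: clgen_sqr. Qed.

(** The involution [J], multiplication by [- I e_1 e_2], acts on [S]. For any
    nonzero [u] in [S], either twice its projection [u + sg J u] is nonzero or [J u] is
    [- sg u]; in the latter case multiplication by [e_3 e_1], which anticommutes
    with [J], carries [u] to the other eigenspace. *)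
Lemma Sweight_neq0 (sg : C) : sg * sg = 1 ->
  exists2 u, u \in Sweight S sg & u != 0.
Proof.
move=> sg2; set B := E i1 i2; set X := E i3 i1.
have E2 i j : i != j -> E i j * E i j = -1.
  move=> ij; rewrite {2}(evec_anticomm ij) /E mulrN mulrA.
  by rewrite -[evec R m i * _ * _]mulrA evec_sqr mulrN1 mulNr opprK evec_sqr.
have BX : B * X = - (X * B).
  rewrite {1}/B {1}/X (@evec_anticomm i1 i2) // (@evec_anticomm i3 i1) //.
  rewrite mulrNN /B /X /E !mulrA.
  rewrite -[_ i2 * _ i1 * _]mulrA -[_ i3 * _ i1 * _]mulrA !evec_sqr.
  by rewrite !mulrN1 !mulNr opprK; apply: esym; apply: evec_anticomm.
pose J u : Cl := - I *: (B * u).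
have JD u v : J (u + v) = J u + J v by rewrite /J mulrDr scalerDr.
have JZ c u : J (c *: u) = c *: J u by rewrite /J -scalerAr !scalerA mulrC.
have JJ u : J (J u) = u.
  by rewrite {1}/J -scalerAr scalerA mulrNN II mulrA E2 // mulN1r scaleN1r opprK.
have SJ u : u \in S -> J u \in S.
  by move=> Su; apply/rpredZ/spinor_bivector.
have SwE u : (u \in Sweight S sg) = (u \in S) && (J u == sg *: u).
  exact: mem_Sweight.
pose u := vpick S.
have Su : u \in S by apply: memv_pick.
have nzu : u != 0.
  by rewrite vpick0 -dimv_eq0; have [-> _] := spinorS.
have [w0|nzw] := eqVneq (u + sg *: J u) 0; last first.
  exists (u + sg *: J u) => //.
  rewrite SwE; apply/andP; split; first exact/rpredD/rpredZ/SJ.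
  by rewrite JD JZ JJ scalerDr scalerA sg2 scale1r addrC.
have Ju : J u = - (sg *: u).
  apply/eqP; rewrite -addr_eq0 addrC -[J u]scale1r -sg2 -scalerA -scalerDr w0.
  by rewrite scaler0.
exists (X * u).
  rewrite SwE spinor_bivector //=.
  rewrite /J mulrA BX mulNr scalerN -mulrA scalerAr -/(J u) Ju.
  by rewrite mulrN opprK -scalerAr.
apply: contraNneq nzu => Xu0.
by rewrite -[u]opprK -mulN1r -(E2 i3 i1 isT) -/X -mulrA mulrN Xu0 oppr0 mulr0.
Qed.
End Spinor.

End Extensions.

(** * The basis and the decomposition into weight lines *)

Section Basis.
Variables (R : realType) (m : nat).
Local Notation C := R[i].
Local Notation Cl := (clifford C (3 + m)).
Local Notation P3 := (clpoly C (3 + m)).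
Local Notation I := ('i%C : C).
Variable S : {vspace Cl}.
Hypothesis spinorS : basic_spinor S.
Variable k : nat.

(** The coefficients of the restriction of [p] to the plane, where [p] is
    homogeneous of degree [k]; coefficients outside [S] are projected so that the
    map is linear on all polynomials. *)
Definition planar_trace (p : P3) : {ffun 'I_k.+1 -> subvs_of S} :=
  [ffun a : 'I_k.+1 => vsproj S p@_(U_(i1) *+ a + U_(i2) *+ (k - a))].

Fact planar_trace_linear : linear planar_trace.
Proof.
move=> c p q; apply/ffunP=> a; rewrite !ffunE addrC mcoeff_lin.
by rewrite linearD linearZ /= addrC.
Qed.

HB.instance Definition _ :=
  GRing.isLinear.Build C P3 _ *:%R planar_trace planar_trace_linear.

Lemma planar_trace_inj p : monogenic k S p -> planar_trace p = 0 -> p = 0.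
Proof.
move=> [Sp hp dp] tr0; apply: monogenic_planar_uniq => // mon mon3.
have [deg|deg] := eqVneq (mdeg mon) k; last exact: (dhomog_nemf_coeff hp).
have sum12 : (mon i1 + mon i2)%N = k.
  rewrite -deg mdegE !big_ord_recl big_ord0 addn0.
  have -> : ord0 = i1 :> 'I_3 by apply: val_inj.
  have -> : lift i1 ord0 = i2 by apply: val_inj.
  have -> : lift i1 (lift ord0 ord0) = i3 by apply: val_inj.
  by rewrite mon3 addn0.
have a_lt : (mon i1 < k.+1)%N by rewrite ltnS -sum12 leq_addr.
have := congr1 (fun g : {ffun 'I_k.+1 -> subvs_of S} => vsval (g (Ordinal a_lt))) tr0.
rewrite !ffunE /= vsprojK; last exact: Sp.
rewrite (_ : (_ + _)%MM = mon) //; apply/mnmP=> -[[|[|[|//]]] lt3].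
- rewrite mnmDE !mulmnE !mnm1E /= mul1n mul0n addn0.
  by congr (mon _); apply: val_inj.
- rewrite mnmDE !mulmnE !mnm1E /= mul1n mul0n add0n -sum12 addKn.
  by congr (mon _); apply: val_inj.
rewrite mnmDE !mulmnE !mnm1E /= !mul0n addn0 -[LHS]mon3.
by congr (mon _); apply: val_inj.
Qed.

Lemma dim_planar_trace : (2 * k + 2)%N = \dim {: {ffun 'I_k.+1 -> subvs_of S}}.
Proof.
rewrite dimvf -[RHS]/(#|'I_k.+1| * \dim S)%N card_ord.
by have [-> _] := spinorS; lia.
Qed.

(** Stability is only assumed under real combinations, which contain each
    [L_ij] separately. *)
Lemma submodule_Lop (W : P3 -> Prop) : submodule (@so3_act R m) W ->
  forall u, W u -> [/\ W (Lop i1 i2 u), W (Lop i2 i3 u) & W (Lop i3 i1 u)].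
Proof.
move=> [subW stable] u Wu.
have act l : so3_act (delta_mx 0 l) u =
    ((i1 == l)%:R : R)%:C%C *: Lop i1 i2 u + ((i2 == l)%:R : R)%:C%C *: Lop i2 i3 u
    + ((i3 == l)%:R : R)%:C%C *: Lop i3 i1 u.
  by rewrite /so3_act !mxE.
move: (stable (delta_mx 0 i1) u Wu) (stable (delta_mx 0 i2) u Wu).
move: (stable (delta_mx 0 i3) u Wu); rewrite !act.
move: (Lop i1 i2 u) (Lop i2 i3 u) (Lop i3 i1 u) => u1 u2 u3.
by rewrite /= !scale1r !scale0r !addr0 !add0r.
Qed.

Variables vp vm : Cl.
Hypotheses (vp_gen : <[vp]>%VS = Splus S) (vm_gen : <[vm]>%VS = Sminus S).

Local Notation f := (gt_family vp vm k).
Local Notation wt n := ((k%:R + 2^-1 - n%:R) : C).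

Let half_le n : (n <= 2 * k + 1)%N -> (n./2 <= k)%N.
Proof. by move=> nk; rewrite -leq_double -mul2n; lia. Qed.

Let generator (sg : C) v : sg * sg = 1 -> <[v]>%VS = Sweight S sg ->
  [/\ v \in S, - I *: (evec R m i1 * evec R m i2 * v) = sg *: v & v != 0].
Proof.
move=> sg2 v_gen.
have := memv_line v; rewrite v_gen mem_Sweight => /andP[Sv /eqP eig]; split=> //.
have [u] := Sweight_neq0 spinorS sg2; rewrite -v_gen => /vlineP[c ->].
by apply: contraNneq => ->; rewrite scaler0.
Qed.

Let plus := generator (mul1r 1) vp_gen.
Let minus : [/\ vm \in S, - I *: (evec R m i1 * evec R m i2 * vm) = -1 *: vm & vm != 0].
Proof. by apply: generator vm_gen; rewrite mulrNN mul1r. Qed.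

Lemma gt_family_weight n : (n <= 2 * k + 1)%N -> Hop (f n) = wt n *: f n.
Proof.
move=> nk; have [_ eigp _] := plus; have [_ eigm _] := minus.
rewrite /gt_family.
have -> : wt n = (if odd n then -1 else 1) / 2 + k%:R - (2 * n./2)%:R.
  rewrite -{1}[n]odd_double_half mul2n natrD.
  by case: odd; rewrite /=; field.
by apply: gt_poly_weight; [apply: half_le|case: odd].
Qed.

Lemma gt_family_neq0 n : (n <= 2 * k + 1)%N -> f n != 0.
Proof.
move=> nk; have [_ _ nzp] := plus; have [_ _ nzm] := minus.
by apply: gt_poly_neq0; [apply: half_le|case: odd].
Qed.

Lemma gt_family_monogenic n : (n <= 2 * k + 1)%N -> monogenic k S (f n).
Proof.
move=> nk; have [Sp _ _] := plus; have [Sm _ _] := minus.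
by apply: gt_poly_monogenic => //; [apply: half_le|case: odd].
Qed.

Let ord_le (j : 'I_(2 * k + 2)) : (j <= 2 * k + 1)%N.
Proof. by rewrite -ltnS -addnS. Qed.

Lemma weight_inj : injective (fun j : 'I_(2 * k + 2) => wt j).
Proof. by move=> j l /addrI/oppr_inj/eqP; rewrite eqr_nat => /eqP/val_inj. Qed.

(** The weights are distinct, so the family is independent; there are as many
    vectors as the dimension of the target of the injective [planar_trace]. *)
Lemma gt_family_basis :
  basis_of_subspace (monogenic k S) (fun j : 'I_(2 * k + 2) => f j).
Proof.
apply: (@independent_spans _ _ _ _ planar_trace).
- exact: monogenic_subspace.
- exact: planar_trace_inj.
- exact: dim_planar_trace.
- by move=> j; apply: gt_family_monogenic.
apply: (@eigenvectors_independent _ _ (- I \*: @Lop R m i1 i2) _ (fun j => wt j)).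
- exact: weight_inj.
- by move=> j; apply: gt_family_weight.
by move=> j; apply: gt_family_neq0.
Qed.

Lemma monogenic_irreducible : irreducible (@so3_act R m) (monogenic k S).
Proof.
have subV := @monogenic_subspace _ m S k.
have LV u : monogenic k S u ->
    [/\ monogenic k S (Lop i1 i2 u), monogenic k S (Lop i2 i3 u)
      & monogenic k S (Lop i3 i1 u)].
  by move=> Vu; split; apply: monogenic_Lop.
split.
- split=> [|a u /LV[V1 V2 V3]]; first exact: subV.
  apply: (subspaceD subV); last exact: (subspaceZ subV).
  by apply: (subspaceD subV); apply: (subspaceZ subV).
- by exists (f 0%N); [apply: gt_family_monogenic | apply: gt_family_neq0].
move=> W subW WV.
apply: (@so3_ladder_irreducible _ P3 (monogenic k S) (2 * k + 2) f (k%:R + 2^-1) I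
  (@Lop R m i1 i2) (@Lop R m i2 i3) (@Lop R m i3 i1)).
- by rewrite -expr2 sqr_i.
- by move=> u; apply: Lop_comm.
- by move=> u; apply: Lop_comm.
- by move=> u; apply: Lop_comm.
- exact: subV.
- exact: LV.
- exact: gt_family_basis.
- by move=> j jn; apply: gt_family_weight; rewrite -ltnS -addnS.
- have -> : (2 * k + 2).-1 = (k + k + 1)%N by lia.
  by rewrite !natrD; field.
- by case: subW.
- exact: WV.
exact: submodule_Lop.
Qed.
End Basis.

Unset Implicit Arguments.

Theorem theorem4 (R : realType) (m : nat) (S : {vspace clifford R[i] (3 + m)})
    (vp vm : clifford R[i] (3 + m))
    (S_spinor : basic_spinor S)
    (vp_gen : <[vp]>%VS = Splus S) (vm_gen : <[vm]>%VS = Sminus S) (k : nat) :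
  gelfand_tsetlin_basis (@so3_act R m) (@so2_act R m) (monogenic k S)
    (fun j : 'I_(2 * k + 2) => gt_family vp vm k j)
  /\ forall j : nat, (j <= 2 * k + 1)%N ->
       Hop (gt_family vp vm k j)
       = ((k%:R + 2^-1 - j%:R) : R[i]) *: gt_family vp vm k j.
Proof.
have weight := gt_family_weight S_spinor vp_gen vm_gen (k := k).
have nz := gt_family_neq0 S_spinor vp_gen vm_gen (k := k).
split; last exact: weight.
have ord_le (j : 'I_(2 * k + 2)) : (j <= 2 * k + 1)%N by rewrite -ltnS -addnS.
have basis := gt_family_basis S_spinor k vp_gen vm_gen.
split; [exact: (monogenic_irreducible S_spinor k vp_gen vm_gen) | exact: basis |].
have actZ (t : R) c p : so2_act t (c *: p) = c *: so2_act t p :> clpoly R[i] (3 + m).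
  by rewrite /so2_act linearZ /= !scalerA mulrC.
have eig (t : R) (j : 'I_(2 * k + 2)) : so2_act t (gt_family vp vm k j) =
    (t%:C%C * ('i%C * (k%:R + 2^-1 - j%:R))) *: gt_family vp vm k j.
  move: (weight j (ord_le j)); rewrite /so2_act /Hop.
  set fj := gt_family _ _ _ _; set Lf := Lop _ _ _ => Hf; clearbody Lf fj.
  by rewrite -!scalerA -Hf !scalerA -mulrA mulrN -expr2 sqr_i opprK mulr1.
exists (fun j => line (gt_family vp vm k j)); split.
- exact/basis_direct_sum/basis/monogenic_subspace.
- move=> j; apply: eigenline_irreducible => //; first exact: nz.
  by move=> t; rewrite eig; eexists.
- move=> i j ij.
  apply: (@eigenline_not_isomorphic _ _ _ _ _ _ _ 1 _ _ _ (eig 1 i) (eig 1 j)).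
  + exact: actZ.
  + exact: nz.
  rewrite !mul1r (inj_eq (mulfI _)) ?(inj_eq (@weight_inj _ _)) //.
  by rewrite -sqrf_eq0 sqr_i oppr_eq0 oner_eq0.
by move=> j; split; [exists 1; rewrite scale1r | apply: nz].
Qed.
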